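(* Let $\mu$ be a measure on $M_k$ and let $H:M_k\to M_k$ be measurable, square integrable with respect to $\mu$ (i.e. $\int_{M_k}\|H(v)\|^2\,d\mu(v)<\infty$), irreducible for $\mu$, and such that $H(v)\neq 0$ for $\mu$-a.e. $v$. Then $$P_\mu(H)=\log\lambda_H ,$$ where $P_\mu(H)$ is the pressure of $H$ and $\lambda_H$ is the spectral radius of $\phi_H$.
   Context: $M_k$ is the set of complex $k\times k$ matrices with its Borel $\sigma$-algebra, $\dagger$ is the conjugate transpose, $\|A\|=\sqrt{\operatorname{tr}(AA^\dagger)}$ is the Hilbert-Schmidt norm; $A\ge 0$ means positive semidefinite and $A>0$ positive definite. Fix a Borel measure $\mu$ on $M_k$ (the a priori measure). For measurable $L:M_k\to M_k$ with $\int\|L(v)\|^2d\mu(v)<\infty$ (square integrable) put $\phi_L(\rho)=\int_{M_k}L(v)\rho L(v)^\dagger d\mu(v)$ and $\phi_L^*(\rho)=\int_{M_k}L(v)^\dagger\rho L(v)\,d\mu(v)$, linear maps on $M_k$. $L$ (or $\phi_L$) is called irreducible for $\mu$ if the only Hermitian projectors $P\in M_k$ with $\phi_L(PM_kP)\subset PM_kP$ are $P=0$ and $P=\mathrm{Id}$. $L$ (or $\phi_L$) is called stochastic if $\phi_L^*(\mathrm{Id})=\mathrm{Id}$. $\phi_\mu$ is the set of all measurable, square integrable $L$ such that $\phi_L$ is irreducible and stochastic. If $L$ is irreducible, $\lambda_L>0$ denotes the common spectral radius of $\phi_L$ and $\phi_L^*$, which is a simple eigenvalue of both; $\rho_L>0$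 is the unique matrix with $\phi_L(\rho_L)=\lambda_L\rho_L$, $\operatorname{tr}\rho_L=1$, and $\sigma_L>0$ is the unique matrix with $\phi_L^*(\sigma_L)=\lambda_L\sigma_L$, $\operatorname{tr}(\sigma_L\rho_L)=1$. Entropy of $L\in\phi_\mu$ (defined when finite): $$h_\mu(L)=-\int_{M_k\times M_k}\operatorname{tr}(L(v)\rho_LL(v)^\dagger)\,P_L(v,w)\log P_L(v,w)\,d\mu(v)d\mu(w),\qquad P_L(v,w)=\frac{\operatorname{tr}(L(w)L(v)\rho_LL(v)^\dagger L(w)^\dagger)}{\operatorname{tr}(L(v)\rho_LL(v)^\dagger)},$$ with $P_L(v,w)=0$ when the denominator vanishes and $0\log 0=0$. For irreducible square integrable $H$ with $H(v)\ne0$ for $\mu$-a.e. $v$, put $U_H(v)=\log\big(\operatorname{tr}(\sigma_HH(v)\rho_HH(v)^\dagger)\big)$ and define the pressure $$P_\mu(H)=P(H)=\sup_{L\in\phi_\mu}\Big\{h_\mu(L)+\int_{M_k}U_H(v)\operatorname{tr}(L(v)\rho_LL(v)^\dagger)\,d\mu(v)\Big\},$$ the supremum being over those $L\in\phi_\mu$ for which $h_\mu(L)$ is defined. *)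

(* Defs.v *)
(* MathComp-Analysis, with R[i] of mathcomp-real-closed as the complex numbers. *)
From HB Require Import structures.
From mathcomp Require Export all_boot all_order all_algebra.
From mathcomp Require Export complex.
From mathcomp Require Export all_classical all_reals all_analysis.

Set Implicit Arguments.
Unset Strict Implicit.
Unset Printing Implicit Defensive.

Import Order.TTheory GRing.Theory Num.Theory.
Import numFieldNormedType.Exports.

Local Open Scope classical_set_scope.
Local Open Scope ring_scope.
Local Open Scope sesquilinear_scope.

(* Square complex matrices with their Borel sets. The alias R[i]^o is what
   carries the usual topology of the complex plane in the library; it is
   convertible to R[i]. *)
Notation borelM R k := (g_sigma_algebraType (@open 'M[R[i]^o]_k)).

Section matrices.
Context {R : realType} {k : nat}.
Implicit Types (A P : 'M[R[i]]_k) (f : 'M[R[i]]_k -> 'M[R[i]]_k).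

Definition trRe A : R := complex.Re (\tr A).

Definition HSnorm A : R := Num.sqrt (trRe (A *m A ^t*)).

Definition posdefmx A : Prop :=
  A ^t* = A /\
  forall x : 'cV[R[i]]_k, x != 0 -> 0 < (x ^t* *m A *m x) 0 0.

Definition hermitian_projector P : Prop := P ^t* = P /\ P *m P = P.

Definition spectral_radius f : R :=
  sup [set complex.Re `|c| |
       c in [set c : R[i] | exists2 A, A != 0 & f A = c *: A]].

End matrices.

Definition cintegral d (T : measurableType d) (R : realType)
    (mu : {measure set T -> \bar R}) (f : T -> R[i]) : R[i] :=
  Complex (\int[mu]_x complex.Re (f x)) (\int[mu]_x complex.Im (f x)).

Section thermodynamics.
Context {R : realType} {k : nat}.
Variable mu : {measure set (borelM R k) -> \bar R}.
Implicit Types L H : borelM R k -> 'M[R[i]]_k.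

Definition square_integrable L : Prop :=
  (\int[mu]_v ((HSnorm (L v) ^+ 2)%:E) < +oo)%E.

Definition measurableM L : Prop :=
  measurable_fun [set: borelM R k] (L : borelM R k -> borelM R k).

Definition phi L (rho : 'M[R[i]]_k) : 'M[R[i]]_k :=
  \matrix_(i, j) cintegral mu (fun v => (L v *m rho *m (L v) ^t*) i j).

Definition phi_star L (rho : 'M[R[i]]_k) : 'M[R[i]]_k :=
  \matrix_(i, j) cintegral mu (fun v => ((L v) ^t* *m rho *m L v) i j).

Definition irreducible L : Prop :=
  forall P : 'M[R[i]]_k, hermitian_projector P ->
    (forall A, exists B, phi L (P *m A *m P) = P *m B *m P) ->
    P = 0 \/ P = 1%:M.

Definition stochastic L : Prop := phi_star L 1%:M = 1%:M.

Definition phi_mu : set (borelM R k -> 'M[R[i]]_k) :=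
  [set L | [/\ measurableM L, square_integrable L, irreducible L
             & stochastic L]].

Definition lambda L : R := spectral_radius (phi L).

(* For irreducible square integrable L each of the two sets below is a
   singleton (Perron-Frobenius); xget picks its element, and 0 is only a
   default value. *)
Definition rhoM L : 'M[R[i]]_k :=
  xget 0 [set rho | [/\ posdefmx rho,
                        phi L rho = ((lambda L)%:C)%C *: rho & \tr rho = 1]].

Definition sigmaM L : 'M[R[i]]_k :=
  xget 0 [set sigma | [/\ posdefmx sigma,
                          phi_star L sigma = ((lambda L)%:C)%C *: sigma
                        & \tr (sigma *m rhoM L) = 1]].

Definition density L v : R := trRe (L v *m rhoM L *m (L v) ^t*).

(* In the library x / 0 = 0 and ln 0 = 0, which gives both the convention
   for a vanishing denominator and 0 log 0 = 0. *)
Definition transition L v w : R :=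
  trRe (L w *m L v *m rhoM L *m (L v) ^t* *m (L w) ^t*) / density L v.

Definition entropy_integrand L (z : borelM R k * borelM R k) : \bar R :=
  (density L z.1 * (transition L z.1 z.2 * ln (transition L z.1 z.2)))%:E.

Definition entropy_defined L : Prop :=
  ((mu \x mu)%E).-integrable setT (entropy_integrand L).

Definition entropy L : \bar R :=
  (- \int[(mu \x mu)]_z entropy_integrand L z)%E.

Definition potential H v : R :=
  ln (trRe (sigmaM H *m H v *m rhoM H *m (H v) ^t*)).

(* When entropy_defined L holds, the positive part of the integrand involving
   potential H is integrable, so that this integral lies in [-oo, +oo[. *)
Definition pressure H : \bar R :=
  ereal_sup [set (entropy L + \int[mu]_v (potential H v * density L v)%:E)%E |
             L in phi_mu `&` entropy_defined].

End thermodynamics.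

(* Main.v *)
From HB Require Import structures.
From mathcomp Require Import fingroup perm.
Require Import Defs.
From mathcomp Require Import ring lra measurable_realfun.
Import Order.TTheory GRing.Theory Num.Theory.
Import numFieldNormedType.Exports.
Local Open Scope classical_set_scope.
Local Open Scope ring_scope.
Local Open Scope sesquilinear_scope.
Set Implicit Arguments.
Unset Strict Implicit.
Unset Printing Implicit Defensive.

(* Write q(v) = tr(L(v) rho_L adj(L(v))), j(v,w) = q(v) P_L(v,w) and p = exp U_H.
   Then q is a probability density, both marginals of j are q, and p has mass
   lambda_H.  The quantity in the supremum is log lambda_H minus the relative
   entropy of j with respect to q(v) p(w) / lambda_H, hence at most
   log lambda_H.  It would be attained if P_L(v,w) = p(w) / lambda_H, which
   holds for L = sqrt(p / lambda_H) U with U unitary.  Since p log p need not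
   be integrable, p is first restricted to {1/n <= p <= n} and normalised by
   its mass Z_n there; the value is then log Z_n, which tends to log lambda_H.
   To make L irreducible, U takes two values, a reflection and a cyclic shift,
   on a set A and on its complement.  If no set A splits mu, then H is a.e.
   constant, so an eigenvector of its value contradicts irreducibility
   (for k > 1).  When lambda_H = 0 (possible only for k = 1 and mu = 0), both
   sides are -oo.
   The Perron-Frobenius eigenvectors come from maximising t subject to
   F rho >= t rho, over density matrices rho. *)

(** * Complex matrices and positive semidefinite forms *)

(** Nothing is assumed on [mu], yet the entropy is an integral over a product. Sigma-finiteness
    comes from H, whose squared norm is integrable and almost everywhere positive. In the upper
    bound the integral of U_H q may be -oo, so the relative entropy cannot be split into separate
    integrals. Instead ln x <= x - 1 yields a pointwise majorant that is integrable on the product,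
    and the comparison is made first in v and then in w. In the lower bound the unitary factor
    cancels in the product of adj(L(v)) and L(v), so it changes no probability: the scalar factor
    alone fixes entropy and energy, and U is free to enforce irreducibility. Irreducibility is
    mostly used in pointwise form: P is 0 or the identity as soon as (1 - P) L(v) P = 0 for almost
    every v. Since [lambda] is a supremum over all complex eigenvalues, a positive eigenvector does
    not identify it at once; the order that this eigenvector defines bounds the other
    eigenvalues. *)

Section LA.
Context {R : realType}.
Local Notation C := R[i].

Lemma adjM m n p (A : 'M[C]_(m, n)) (B : 'M[C]_(n, p)) :
  (A *m B) ^t* = B ^t* *m A ^t*.
Proof. by rewrite trmx_mul map_mxM. Qed.

Lemma adjD m n (A B : 'M[C]_(m, n)) : (A + B) ^t* = A ^t* + B ^t*.
Proof. by rewrite linearD /= map_mxD. Qed.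

Lemma adjN m n (A : 'M[C]_(m, n)) : (- A) ^t* = - A ^t*.
Proof. by rewrite linearN /= map_mxN. Qed.

Lemma adjZ m n (c : C) (A : 'M[C]_(m, n)) : (c *: A) ^t* = c^* *: A ^t*.
Proof. by rewrite linearZ /= map_mxZ. Qed.

Lemma adj0 m n : (0 : 'M[C]_(m, n)) ^t* = 0.
Proof. by rewrite trmx0 map_mx0. Qed.

Lemma adj1 n : (1%:M : 'M[C]_n) ^t* = 1%:M.
Proof. by rewrite trmx1 map_mx1. Qed.

Lemma cReD (x y : C) : complex.Re (x + y) = complex.Re x + complex.Re y.
Proof. by case: x; case: y. Qed.
Lemma cImD (x y : C) : complex.Im (x + y) = complex.Im x + complex.Im y.
Proof. by case: x; case: y. Qed.
Lemma cReN (x : C) : complex.Re (- x) = - complex.Re x.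
Proof. by case: x. Qed.
Lemma cImN (x : C) : complex.Im (- x) = - complex.Im x.
Proof. by case: x. Qed.
Lemma cReM (x y : C) : complex.Re (x * y) =
  complex.Re x * complex.Re y - complex.Im x * complex.Im y.
Proof. by case: x; case: y. Qed.
Lemma cImM (x y : C) : complex.Im (x * y) =
  complex.Re x * complex.Im y + complex.Im x * complex.Re y.
Proof. by case: x; case: y. Qed.
Lemma cReJ (x : C) : complex.Re x^* = complex.Re x.
Proof. by case: x. Qed.
Lemma cImJ (x : C) : complex.Im x^* = - complex.Im x.
Proof. by case: x. Qed.
Lemma cReZ (a : R) (x : C) : complex.Re (a%:C%C * x) = a * complex.Re x.
Proof. by rewrite cReM mul0r subr0. Qed.
Lemma cRe_sum I (r : seq I) (P : pred I) (f : I -> C) :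
  complex.Re (\sum_(i <- r | P i) f i) = \sum_(i <- r | P i) complex.Re (f i).
Proof. by elim/big_rec2: _ => // i x y _ <-; rewrite cReD. Qed.
Lemma cIm_sum I (r : seq I) (P : pred I) (f : I -> C) :
  complex.Im (\sum_(i <- r | P i) f i) = \sum_(i <- r | P i) complex.Im (f i).
Proof. by elim/big_rec2: _ => // i x y _ <-; rewrite cImD. Qed.
Lemma complexP (x y : C) :
  complex.Re x = complex.Re y -> complex.Im x = complex.Im y -> x = y.
Proof. by case: x; case: y => ? ? ? ? /= -> ->. Qed.
Lemma cReMJ (x : C) : complex.Re (x * x^*) = complex.Re x ^+ 2 + complex.Im x ^+ 2.
Proof. by rewrite cReM cReJ cImJ !expr2; lra. Qed.

Context {k : nat}.
Implicit Types (A B D Y : 'M[C]_k) (x y : 'cV[C]_k).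

Definition qf A x y : C := (x ^t* *m A *m y) 0 0.

Lemma qfDm A B x y : qf (A + B) x y = qf A x y + qf B x y.
Proof. by rewrite /qf mulmxDr mulmxDl mxE. Qed.
Lemma qfNm A x y : qf (- A) x y = - qf A x y.
Proof. by rewrite /qf mulmxN mulNmx mxE. Qed.
Lemma qfBm A B x y : qf (A - B) x y = qf A x y - qf B x y.
Proof. by rewrite qfDm qfNm. Qed.
Lemma qfZm c A x y : qf (c *: A) x y = c * qf A x y.
Proof. by rewrite /qf -scalemxAr -scalemxAl mxE. Qed.
Lemma qfZl c A x y : qf A (c *: x) y = c^* * qf A x y.
Proof. by rewrite /qf adjZ -!scalemxAl mxE. Qed.
Lemma qfZr c A x y : qf A x (c *: y) = c * qf A x y.
Proof. by rewrite /qf -scalemxAr mxE. Qed.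
Lemma qfJ A x y : (qf A x y)^* = qf (A ^t*) y x.
Proof.
rewrite /qf -[RHS]/((y ^t* *m A ^t* *m x) 0 0).
have -> : y ^t* *m A ^t* *m x = (x ^t* *m A *m y) ^t*.
  by rewrite !adjM trmxCK mulmxA.
by rewrite !mxE.
Qed.
Lemma qf_mul A B D x y : qf (A *m B *m D) x y = qf B (A ^t* *m x) (D *m y).
Proof. by rewrite /qf adjM trmxCK !mulmxA. Qed.

(** The squared Euclidean norm: working with squares keeps all bounds free of roots. *)
Definition nrm x : R := complex.Re (qf 1%:M x x).

Lemma nrmE x : nrm x = \sum_i (complex.Re (x i 0) ^+ 2 + complex.Im (x i 0) ^+ 2).
Proof.
rewrite /nrm /qf mulmx1 mxE cRe_sum; apply: eq_bigr => i _.
by rewrite !mxE mulrC cReMJ.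
Qed.

Lemma qf1 x : qf 1%:M x x = (nrm x)%:C%C.
Proof.
apply: complexP => //=; rewrite /qf mulmx1 mxE cIm_sum big1 // => i _.
by rewrite !mxE cImM cReJ cImJ; lra.
Qed.

Lemma nrm_ge0 x : 0 <= nrm x.
Proof. by rewrite nrmE sumr_ge0 // => i _; rewrite addr_ge0 // sqr_ge0. Qed.

Lemma nrm_eq0 x : (nrm x == 0) = (x == 0).
Proof.
apply/eqP/eqP => [|->]; last first.
  by rewrite nrmE big1 // => i _; rewrite mxE /= expr0n addr0.
rewrite nrmE => /eqP; rewrite psumr_eq0 => [/allP h|i _]; last first.
  by rewrite addr_ge0 // sqr_ge0.
apply/matrixP => i j; rewrite ord1 mxE.
have /= := h i (mem_index_enum _).
by rewrite paddr_eq0 ?sqr_ge0 // !sqrf_eq0 => /andP[/eqP ? /eqP ?]; apply: complexP.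
Qed.

(** Positivity is stated on real parts so that every inequality lives in [R]; [psd_herm] makes the
    imaginary part vanish. *)
Record psd A : Prop := Psd
  { psd_herm : A ^t* = A; psd_ge0 : forall x, 0 <= complex.Re (qf A x x) }.

Lemma qf_herm A x : A ^t* = A -> qf A x x = (complex.Re (qf A x x))%:C%C.
Proof.
move=> hA; apply: complexP => //=.
by have /(congr1 (@complex.Im R)) := qfJ A x x; rewrite hA cImJ; lra.
Qed.

Lemma posdefP A : posdefmx A <->
  A ^t* = A /\ forall x, x != 0 -> 0 < complex.Re (qf A x x).
Proof.
split=> -[hA h]; split=> // x x0; have := h x x0; rewrite -/(qf A x x).
  by rewrite ltcE => /andP[].
by rewrite (qf_herm x hA) ltcR.
Qed.

Lemma posdef_psd A : posdefmx A -> psd A.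
Proof.
move=> /posdefP[hA h]; split=> // x; have [->|/h/ltW //] := eqVneq x 0.
by rewrite /qf mulmx0 mxE.
Qed.

(** Spectral theorem with the square roots of the eigenvalues. Through it, positivity, kernels and
    traces of [A] become statements on the squared norm of [B]. *)
Lemma psd_factor A : psd A -> exists B, A = B *m B ^t*.
Proof.
move=> [hA A0].
have herm : A \is hermsymmx.
  by apply/is_hermitianmxP; rewrite expr0 scale1r hA.
have /orthomx_spectralP := hermitian_normalmx herm.
set P := spectralmx A; set d := spectral_diag A => AE.
have uP : P \is unitarymx by exact: spectral_unitarymx.
rewrite invmx_unitary // in AE.
have dE i : d 0 i = qf A (P ^t* *m delta_mx i 0) (P ^t* *m delta_mx i 0).
  have dd : diag_mx d = P *m A *m P ^t*.
    by rewrite AE !mulmxA mulmxtVK //; have /unitarymxP -> := uP; rewrite mul1mx.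
  rewrite -qf_mul -dd /qf.
  rewrite trmx_delta map_delta_mx -rowE -colE !mxE eqxx mulr1n //.
have d_ge0 i : 0 <= d 0 i.
  by rewrite dE qf_herm // ler0c A0.
pose s := \row_i sqrtC (d 0 i).
exists (P ^t* *m diag_mx s).
rewrite adjM trmxCK {1}AE -!mulmxA; congr (_ *m _); rewrite !mulmxA; congr (_ *m _).
rewrite tr_diag_mx map_diag_mx mulmx_diag; congr diag_mx.
apply/rowP => i; rewrite !mxE.
rewrite -[RHS]/(sqrtC (d 0 i) * (sqrtC (d 0 i))^*) -normCK ger0_norm ?sqrtCK //.
by rewrite sqrtC_ge0.
Qed.

Lemma factor_qf A B x : A = B *m B ^t* -> complex.Re (qf A x x) = nrm (B ^t* *m x).
Proof. by move=> ->; rewrite /nrm -qf_mul mulmx1. Qed.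

Lemma psd_mulBB B : psd (B *m B ^t*).
Proof.
split=> [|x]; first by rewrite adjM trmxCK.
by rewrite (factor_qf x (erefl _)) nrm_ge0.
Qed.

Lemma psd_ker A x : psd A -> complex.Re (qf A x x) = 0 -> A *m x = 0.
Proof.
move=> /psd_factor[B AE]; rewrite (factor_qf x AE) => /eqP; rewrite nrm_eq0 => /eqP h.
by rewrite AE -mulmxA h mulmx0.
Qed.

Lemma psdD A B : psd A -> psd B -> psd (A + B).
Proof.
move=> [hA pA] [hB pB]; split=> [|x]; first by rewrite adjD hA hB.
by rewrite qfDm cReD addr_ge0.
Qed.

Lemma psdZ (t : R) A : 0 <= t -> psd A -> psd (t%:C%C *: A).
Proof.
move=> t0 [hA pA]; split=> [|x]; first by rewrite adjZ conj_Creal ?hA // complex_real.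
by rewrite qfZm cReZ mulr_ge0.
Qed.

Lemma posdef_unit A : posdefmx A -> A \in unitmx.
Proof.
move=> /posdefP[hA pA]; rewrite -row_free_unit -kermx_eq0; apply/eqP/row_matrixP => i.
rewrite row0; set u := row i _.
have uA : u *m A = 0 by apply/sub_kermxP; exact: row_sub.
apply/eqP; apply: contraT => u0.
have := pA (u ^t*); rewrite /qf trmxCK uA mul0mx mxE ltxx => ->//.
by apply: contra u0 => /eqP h; rewrite -[u]trmxCK h adj0.
Qed.

Lemma posdef_factor A : posdefmx A ->
  exists2 B, A = B *m B ^t* & B \in unitmx.
Proof.
move=> pA; have [B AE] := psd_factor (posdef_psd pA).
by exists B => //; have := posdef_unit pA; rewrite AE unitmx_mul => /andP[].
Qed.

Lemma form_bound A : exists2 c : R, 0 < c &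
  forall x y, `|complex.Re (qf A x y)| <= c * (nrm x + nrm y).
Proof.
pose a i j := `|complex.Re (A i j)| + `|complex.Im (A i j)|.
have a0 i j : 0 <= a i j by rewrite addr_ge0.
(* The summand 1 keeps the constant positive when [A] is 0. The factor 2 counts the two real
   products that multiply each real or imaginary part of an entry. *)
exists (1 + 2 * \sum_j \sum_i a i j) => [|x y].
  by rewrite ltr_wpDr ?ltr01 ?mulr_ge0 ?sumr_ge0 // => j _; rewrite sumr_ge0.
have nx i : complex.Re (x i 0) ^+ 2 + complex.Im (x i 0) ^+ 2 <= nrm x.
  rewrite nrmE (bigD1 i) //= lerDl sumr_ge0 // => j _.
  by rewrite addr_ge0 // sqr_ge0.
have ny i : complex.Re (y i 0) ^+ 2 + complex.Im (y i 0) ^+ 2 <= nrm y.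
  rewrite nrmE (bigD1 i) //= lerDl sumr_ge0 // => j _.
  by rewrite addr_ge0 // sqr_ge0.
apply: (@le_trans _ _ (\sum_j \sum_i 2 * a i j * (nrm x + nrm y))); last first.
  have -> : \sum_j \sum_i 2 * a i j * (nrm x + nrm y) =
     2 * (\sum_j \sum_i a i j) * (nrm x + nrm y).
    rewrite mulr_sumr mulr_suml; apply: eq_bigr => j _.
    by rewrite mulr_sumr mulr_suml.
  by rewrite ler_wpM2r ?addr_ge0 ?nrm_ge0 // lerDr ler01.
rewrite /qf mxE cRe_sum; apply: le_trans (ler_norm_sum _ _ _) _; apply: ler_sum => j _.
rewrite mxE mulr_suml cRe_sum; apply: le_trans (ler_norm_sum _ _ _) _; apply: ler_sum => i _.
have := nx i; have := ny j; rewrite !mxE /a !cReM !cImM cReJ cImJ.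
move: (complex.Re (x i 0)) (complex.Im (x i 0)) (complex.Re (y j 0))
  (complex.Im (y j 0)) (complex.Re (A i j)) (complex.Im (A i j)) => p q r s b c h1 h2.
have k1 (u v : R) : u ^+ 2 <= nrm x -> v ^+ 2 <= nrm y ->
   - (nrm x + nrm y) <= u * v <= nrm x + nrm y.
  by move=> hu hv; apply/andP; split; nra.
have q1 := sqr_ge0 p; have q2 := sqr_ge0 q; have q3 := sqr_ge0 r; have q4 := sqr_ge0 s.
have /andP[pr1 pr2] : - (nrm x + nrm y) <= p * r <= nrm x + nrm y by apply: k1; lra.
have /andP[ps1 ps2] : - (nrm x + nrm y) <= p * s <= nrm x + nrm y by apply: k1; lra.
have /andP[qr1 qr2] : - (nrm x + nrm y) <= q * r <= nrm x + nrm y by apply: k1; lra.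
have /andP[qs1 qs2] : - (nrm x + nrm y) <= q * s <= nrm x + nrm y by apply: k1; lra.
set N := nrm x + nrm y in pr1 pr2 ps1 ps2 qr1 qr2 qs1 qs2 *.
have -> : (p * b - - q * c) * r - (p * c + - q * b) * s =
  b * (p * r + q * s) + c * (q * r - p * s) by ring.
have -> : 2 * (`|b| + `|c|) * N = `|b| * (2 * N) + `|c| * (2 * N) by ring.
apply: le_trans (ler_normD _ _) _; rewrite !normrM.
by rewrite lerD // ler_wpM2l // ler_norml; apply/andP; split; lra.
Qed.

(* Factor A = B B^* and apply form_bound to the inverse of A. *)
Lemma posdef_lower A : posdefmx A -> exists2 c : R, 0 < c &
  forall x, nrm x <= c * complex.Re (qf A x x).
Proof.
move=> /posdef_factor[B AE uB].
have [c c0 hc] := form_bound (invmx B *m (invmx B) ^t*).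
exists (2 * c) => [|x]; first by rewrite mulr_gt0.
rewrite (factor_qf x AE); have := hc (B ^t* *m x) (B ^t* *m x).
have -> : qf (invmx B *m (invmx B)^t*) (B^t* *m x) (B^t* *m x) = qf 1%:M x x.
  rewrite /qf adjM trmxCK !mulmxA mulmx1 -(mulmxA (x ^t*)) mulmxV // mulmx1.
  by rewrite -(mulmxA (x ^t*)) -adjM mulmxV // adj1 mulmx1.
by move=> /(le_trans (ler_norm _)) h; rewrite /nrm in h *; lra.
Qed.

(** Positive definite matrices are interior points of the cone; this gives room for a strictly
    larger bound in [perron_frobenius]. *)
Lemma posdef_dominates A D : posdefmx A -> D ^t* = D ->
  exists2 e : R, 0 < e & psd (A - e%:C%C *: D).
Proof.
move=> pA hD; have [c c0 hc] := posdef_lower pA; have [d d0 hd] := form_bound D.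
(* The form of [D] at x is at most 2 d [nrm x] by [hd] with y = x, and [nrm x] is at most c times
   the form of [A] by [hc]. *)
exists (2 * c * d)^-1; first by rewrite invr_gt0 !mulr_gt0.
split=> [|x].
  have [hA _] := pA.
  by rewrite adjD adjN adjZ hA hD conj_Creal // complex_real.
rewrite qfBm cReD cReN qfZm cReZ subr_ge0 ler_pdivrMl ?mulr_gt0 //.
have := le_trans (ler_norm _) (hd x x); move/le_trans; apply.
have := hc x; nra.
Qed.

Lemma trRe_psd_ge0 A : psd A -> 0 <= trRe A.
Proof.
move=> [_ h]; rewrite /trRe /mxtrace cRe_sum sumr_ge0 // => i _.
have := h (delta_mx i 0); rewrite /qf trmx_delta map_delta_mx -rowE -colE !mxE //.
Qed.

Lemma trRe_BB B : trRe (B *m B ^t*) = \sum_i \sum_j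
  (complex.Re (B i j) ^+ 2 + complex.Im (B i j) ^+ 2).
Proof.
rewrite /trRe /mxtrace cRe_sum; apply: eq_bigr => i _; rewrite mxE cRe_sum.
by apply: eq_bigr => j _; rewrite !mxE cReMJ.
Qed.

Lemma trRe_BB_eq0 B : trRe (B *m B ^t*) = 0 -> B = 0.
Proof.
have s0 (x : C) : 0 <= complex.Re x ^+ 2 + complex.Im x ^+ 2.
  by rewrite addr_ge0 // sqr_ge0.
rewrite trRe_BB => /eqP; rewrite psumr_eq0 => [/allP h|i _]; last exact: sumr_ge0.
apply/matrixP => i j; have := h i (mem_index_enum _).
rewrite /= psumr_eq0 => [/allP/(_ j (mem_index_enum _))/=|? _ //].
by rewrite paddr_eq0 ?sqr_ge0 // !sqrf_eq0 mxE => /andP[/eqP ? /eqP ?]; apply: complexP.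
Qed.

Lemma psd_trRe_eq0 A : psd A -> trRe A = 0 -> A = 0.
Proof. by move=> /psd_factor[B ->] /trRe_BB_eq0 ->; rewrite mul0mx. Qed.

Lemma herm_tr A : A ^t* = A -> \tr A = (trRe A)%:C%C.
Proof.
move=> hA; apply: complexP => //=; rewrite /mxtrace cIm_sum big1 // => i _.
by have := congr1 (fun M : 'M[C]_k => complex.Im (M i i)) hA; rewrite !mxE cImJ; lra.
Qed.

End LA.

Section LA2.
Context {R : realType} {k : nat}.
Local Notation C := R[i].
Implicit Types (A B D Y : 'M[C]_k) (x y : 'cV[C]_k).

Lemma herm_diag (Y : 'M[C]_k) : Y ^t* = Y -> exists (U : 'M[C]_k) (d : 'rV[C]_k),
  U *m U ^t* = 1%:M /\ Y = U ^t* *m diag_mx d *m U.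
Proof.
move=> hY.
have herm : Y \is hermsymmx.
  by apply/is_hermitianmxP; rewrite expr0 scale1r hY.
have /orthomx_spectralP := hermitian_normalmx herm.
have uU := spectral_unitarymx Y; rewrite invmx_unitary // => YE.
by exists (spectralmx Y), (spectral_diag Y); split; first exact/unitarymxP.
Qed.

(** [P] is the projector on the range of [Y] and [Z] the pseudo-inverse; the convention 0^-1 = 0
    handles the zero eigenvalues. *)
Lemma psd_support (Y : 'M[C]_k) : Y ^t* = Y -> exists P Z,
  [/\ hermitian_projector P, Y *m P = Y & P = Z *m Y].
Proof.
move=> /herm_diag[U [d [uU YE]]].
have cancel (a b : 'rV[C]_k) : (U ^t* *m diag_mx a *m U) *m (U ^t* *m diag_mx b *m U) =
    U ^t* *m diag_mx (\row_i (a 0 i * b 0 i)) *m U.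
  rewrite -(mulmx_diag a b) -!mulmxA; congr (_ *m (_ *m _)).
  by rewrite !mulmxA uU mul1mx.
exists (U ^t* *m diag_mx (\row_i (d 0 i != 0)%:R) *m U),
       (U ^t* *m diag_mx (\row_i (d 0 i)^-1) *m U); split.
- split; last first.
    rewrite cancel; apply: (congr1 (fun v => U ^t* *m diag_mx v *m U)); apply/rowP => i;
      rewrite !mxE.
    by case: eqP => _; rewrite ?mul0r ?mul1r.
  rewrite !adjM trmxCK tr_diag_mx map_diag_mx mulmxA; congr (_ *m diag_mx _ *m _).
  by apply/rowP => i; rewrite !mxE rmorph_nat.
- rewrite [X in X *m _]YE cancel [X in _ = X]YE; apply: (congr1 (fun v =>
  U ^t* *m diag_mx v *m U)); apply/rowP => i; rewrite !mxE.
  by case: eqP => [->|_]; rewrite ?mul0r ?mulr1.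
- rewrite [X in _ = _ *m X]YE cancel; apply: (congr1 (fun v => U ^t* *m diag_mx v *m U));
  apply/rowP => i; rewrite !mxE.
  by have [->|?] := eqVneq (d 0 i) 0; rewrite ?mulr0 ?mulVf.
Qed.

Lemma qf_sum I (r : seq I) (P : pred I) (M : I -> 'M[C]_k) x y :
  qf (\sum_(i <- r | P i) M i) x y = \sum_(i <- r | P i) qf (M i) x y.
Proof.
by elim/big_rec2: _ => [|i a b _ <-]; rewrite ?qfDm // /qf mulmx0 mul0mx mxE.
Qed.

Lemma psd_qf_bound A x y : psd A ->
  2 * complex.Re (qf A x y) <= complex.Re (qf A x x) + complex.Re (qf A y y).
Proof.
move=> [hA pA]; have := pA (x + (- 1) *: y).
have qfDl u v w : qf A (u + v) w = qf A u w + qf A v w.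
  by rewrite /qf adjD !mulmxDl mxE.
have qfDr u v w : qf A u (v + w) = qf A u v + qf A u w.
  by rewrite /qf mulmxDr mxE.
have : complex.Re (qf A y x) = complex.Re (qf A x y) by rewrite -cReJ qfJ hA.
rewrite qfDl !qfDr !qfZl !qfZr rmorphN rmorph1 !mulN1r opprK !(cReD, cReN) => ->.
move: (complex.Re _) (complex.Re _) (complex.Re _) => a b c; lra.
Qed.

Lemma qf_delta A i j : qf A (delta_mx i 0) (delta_mx j 0) = A i j.
Proof. by rewrite /qf trmx_delta map_delta_mx -rowE -colE !mxE. Qed.

Lemma psd_entry_bound A i j : psd A ->
  `|complex.Re (A i j)| <= trRe A /\ `|complex.Im (A i j)| <= trRe A.
Proof.
move=> pA.
have dg l : 0 <= complex.Re (A l l) <= trRe A.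
  have pd m : 0 <= complex.Re (A m m) by rewrite -qf_delta psd_ge0.
  rewrite pd /trRe /mxtrace cRe_sum (bigD1 l) //= lerDl sumr_ge0 // => m _.
have dgi := dg i; have dgj := dg j.
(* Rotating the second basis vector by c = 1, -1, -i, i extracts the real and imaginary parts of the
   entry with both signs. *)
have b (c : C) : c * c^* = 1 -> 2 * complex.Re (c * A i j) <= 2 * trRe A.
  move=> cc; have := psd_qf_bound (delta_mx i 0) (c *: delta_mx j 0) pA.
  rewrite qfZl !qfZr !qf_delta mulrA (mulrC c^*) cc mul1r.
  move: (complex.Re _) (complex.Re _) (complex.Re _) (trRe A) dgi dgj => p q r t.
  by move=> /andP[? ?] /andP[? ?]; lra.
have b1 : 2 * complex.Re (A i j) <= 2 * trRe A.
  by have := b 1; rewrite !mul1r rmorph1; apply.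
have b2 : 2 * - complex.Re (A i j) <= 2 * trRe A.
  by have := b (-1); rewrite [-1 * A i j]mulN1r cReN; apply;
    rewrite rmorphN rmorph1 mulrNN mulr1.
have iE : 'i%C * ('i%C)^* = 1 :> C.
  by apply: complexP; rewrite ?cReM ?cImM ?cReJ ?cImJ /=; lra.
have b3 : 2 * complex.Im (A i j) <= 2 * trRe A.
  have Ei : complex.Re (- 'i%C * A i j) = complex.Im (A i j).
    by case: (A i j) => p q /=; ring.
  by have := b (- 'i%C); rewrite Ei; apply; rewrite rmorphN mulrNN iE.
have b4 : 2 * - complex.Im (A i j) <= 2 * trRe A.
  have Ei : complex.Re ('i%C * A i j) = - complex.Im (A i j).
    by case: (A i j) => p q /=; ring.
  by have := b 'i%C iE; rewrite Ei.
by rewrite !ler_norml; split; apply/andP; split; lra.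
Qed.

Lemma trReD A B : trRe (A + B) = trRe A + trRe B.
Proof. by rewrite /trRe mxtraceD cReD. Qed.
Lemma trReN A : trRe (- A) = - trRe A.
Proof. by rewrite /trRe raddfN cReN. Qed.
Lemma trReB A B : trRe (A - B) = trRe A - trRe B.
Proof. by rewrite trReD trReN. Qed.
Lemma trReZ (a : R) A : trRe (a%:C%C *: A) = a * trRe A.
Proof. by rewrite /trRe mxtraceZ cReZ. Qed.
Lemma trRe_sum I (r : seq I) (P : pred I) (f : I -> 'M[C]_k) :
  trRe (\sum_(i <- r | P i) f i) = \sum_(i <- r | P i) trRe (f i).
Proof. by apply: (big_morph _ trReD); rewrite /trRe mxtrace0. Qed.
Lemma trRe1 : trRe (1%:M : 'M[C]_k) = k%:R.
Proof.
rewrite /trRe /mxtrace cRe_sum (eq_bigr (fun=> 1)) => [|i _]; last by rewrite !mxE eqxx.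
by rewrite sumr_const card_ord.
Qed.

End LA2.

(** * Perron-Frobenius theory for positive maps of matrices *)

Section linear_maps.
Context {R : realType} {k : nat}.
Local Notation C := R[i].

Lemma linear_deltaE (F : {linear 'M[C]_k ->
  'M[C]_k}) A : F A = \sum_i \sum_j A i j *: F (delta_mx i j).
Proof.
rewrite {1}[A]matrix_sum_delta linear_sum; apply: eq_bigr => i _.
by rewrite linear_sum; apply: eq_bigr => j _; rewrite linearZ.
Qed.

(** An explicit real linear expression in the coordinates of [A], from which continuity follows in
    [collatz_wielandt_max]. *)
Lemma qf_linearE (F : {linear 'M[C]_k ->
  'M[C]_k}) A x : complex.Re (qf (F A) x x) = \sum_i \sum_j
  (complex.Re (A i j) * complex.Re (qf (F (delta_mx i j)) x x)
  - complex.Im (A i j) * complex.Im (qf (F (delta_mx i j)) x x)).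
Proof.
rewrite linear_deltaE qf_sum cRe_sum; apply: eq_bigr => i _.
rewrite qf_sum cRe_sum; apply: eq_bigr => j _.
by rewrite qfZm cReM.
Qed.

Lemma qf_entriesE (A : 'M[C]_k) x : complex.Re (qf A x x) = \sum_i \sum_j
  (complex.Re (A i j) * complex.Re (qf (delta_mx i j) x x)
  - complex.Im (A i j) * complex.Im (qf (delta_mx i j) x x)).
Proof.
rewrite {1}[A]matrix_sum_delta qf_sum cRe_sum; apply: eq_bigr => i _.
rewrite qf_sum cRe_sum; apply: eq_bigr => j _.
by rewrite qfZm cReM.
Qed.

End linear_maps.

Section PF.
Context {R : realType} {k : nat}.
Local Notation C := R[i].
Variable F : {linear 'M[C]_k -> 'M[C]_k}.
Hypothesis k_gt0 : (0 < k)%N.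
Hypothesis F_psd : forall A, psd A -> psd (F A).
(** Irreducibility in terms of kernels: the condition on x says that the range of [F Y] lies in the
    range of [Y]. *)
Hypothesis F_irr : forall Y, psd Y -> Y != 0 ->
  (forall x : 'cV_k, Y *m x = 0 -> F Y *m x = 0) -> posdefmx Y.

(** Adding the identity makes kernels decrease along the iterates; [F] alone could permute them
    cyclically. *)
Let step (A : 'M[C]_k) := A + F A.

Lemma step_psd A : psd A -> psd (step A).
Proof. by move=> pA; apply: psdD => //; exact: F_psd. Qed.

Lemma iter_step_psd n A : psd A -> psd (iter n step A).
Proof. by move=> pA; elim: n => //= n ih; exact: step_psd. Qed.

Lemma step_ker A (x : 'cV_k) : psd A -> step A *m x = 0 -> A *m x = 0.
Proof.
move=> pA h; apply: psd_ker => //.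
have pF := F_psd pA; have [_ /(_ x) h1] := pA; have [_ /(_ x) h2] := pF.
have : complex.Re (qf (step A) x x) = 0 by rewrite /qf -mulmxA h mulmx0 mxE.
rewrite qfDm cReD; move: h1 h2.
move: (complex.Re _) (complex.Re _) => a b; lra.
Qed.

(* If the rank did not grow, the kernel of A would be F-stable. *)
Lemma rank_step A : psd A -> A != 0 -> ~ posdefmx A -> (\rank A < \rank (step A))%N.
Proof.
move=> pA A0 npA.
have sub : (A <= step A)%MS.
  rewrite submxE; apply/eqP/matrixP => i j.
  have colM (D E : 'M[C]_k) : D *m col j E = col j (D *m E).
    by rewrite !colE mulmxA.
  have := step_ker (x := col j (cokermx (step A))) pA.
  rewrite !colM mulmx_coker => h.
  have /h/(congr1 (fun M : 'cV_k => M i 0)) : col j (0 : 'M[C]_k) = 0.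
    by apply/matrixP => a b; rewrite !mxE.
  by rewrite !mxE.
rewrite ltn_neqAle mxrankS // andbT; apply/negP => /eqP h.
apply: npA; apply: F_irr => // x Ax.
have : (step A <= A)%MS by move: (mxrank_leqif_sup sub) => /leqifP; case: ifP => // _;
  rewrite h ltnn.
move=> /submxP[M h2].
have : step A *m x = 0 by rewrite h2 -mulmxA Ax mulmx0.
by rewrite /step mulmxDl Ax add0r.
Qed.

Lemma iter_step_posdef A : psd A -> A != 0 -> exists n, posdefmx (iter n step A).
Proof.
(* Induction on the corank, which drops at each step until the matrix is positive definite. *)
move: {2}(k - \rank A)%N (erefl (k - \rank A)%N) => m.
elim/ltn_ind: m A => m ih A mE pA A0.
have [pd|npd] := pselect (posdefmx A); first by exists 0%N.
have rk := rank_step pA A0 npd.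
have rk2 := rank_leq_row (step A).
have [|||n hn] := ih (k - \rank (step A))%N _ (step A) erefl.
- by rewrite -mE ltn_sub2l // (leq_trans rk).
- exact: step_psd.
- by rewrite -mxrank_eq0 -lt0n (leq_ltn_trans _ rk).
by exists n.+1; rewrite iterSr.
Qed.

(** [step] is a polynomial in [F], so it commutes with [F] and iterating it on the defect of a
    matrix produces the defect of the iterate. *)
Lemma iter_step_sub n (r : C) A :
  iter n step (F A - r *: A) = F (iter n step A) - r *: iter n step A.
Proof.
by elim: n => //= n ->; rewrite /step !linearD !linearN /= !linearZ /= addrACA.
Qed.

(** Taking traces in F A >= t A bounds t by [c], so the maximisation takes place on a compact
    set. *)
Lemma trRe_F_bound : exists2 c : R, 0 <= c & forall A, psd A -> trRe A = 1 ->
  trRe (F A) <= c.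
Proof.
pose a i j := `|complex.Re (\tr (F (delta_mx i j)))| + `|complex.Im (\tr (F (delta_mx i j)))|.
exists (\sum_i \sum_j a i j) => [|A pA trA].
  by apply: sumr_ge0 => i _; apply: sumr_ge0 => j _; rewrite addr_ge0.
rewrite linear_deltaE trRe_sum; apply: ler_sum => i _.
rewrite trRe_sum; apply: ler_sum => j _.
have [h1 h2] := psd_entry_bound i j pA; rewrite trA in h1 h2.
rewrite /trRe mxtraceZ cReM; apply: le_trans (ler_norm _) _.
apply: le_trans (ler_normB _ _) _; rewrite !normrM lerD // ler_piMl //.
Qed.

Lemma collatz_wielandt_max : exists (r : R) (rho : 'M[C]_k),
  [/\ 0 <= r, psd rho, trRe rho = 1, psd (F rho - r%:C%C *: rho) &
   forall t A, 0 <= t -> psd A -> trRe A = 1 -> psd (F A - t%:C%C *: A) -> t <= r].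
Proof.
have [c c0 hc] := trRe_F_bound.
(* A point is a family of real numbers: the real and imaginary parts of the entries, and at [None]
   the value t to be maximised. Compactness is then Tychonoff for segments. *)
pose I := option ('I_k * 'I_k * bool).
pose X := {ptws I -> R}.
pose B (u : X) : 'M[C]_k :=
  \matrix_(i, j) Complex (u (Some (i, j, true))) (u (Some (i, j, false))).
(* Symmetrising makes [M u] Hermitian at every point, so this is not a constraint on [u]. It also
   explains the halved entries in the point attached to a given [A] below. *)
pose M u := B u + (B u) ^t*.
pose K : set X := [set u | forall i, (if i is Some _ then `[-1, 1] else `[0, c])%classic (u i)].
have cK : compact K.
  pose Ai (i : I) : set R := (if i is Some _ then `[-1, 1] else `[0, c])%classic.
  by apply: (@tychonoff I (fun=> R) Ai) => -[i|]; exact: segment_compact.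
pose S := [set u : X | [/\ trRe (M u) = 1, (forall x, 0 <= complex.Re (qf (M u) x x)) &
   (forall x, 0 <= complex.Re (qf (F (M u) - (u None)%:C%C *: M u) x x))]].

have cpr (i : I) : continuous (fun u : X => u i) by exact: proj_continuous.
have cext (f g : X -> R) : f =1 g -> continuous g -> continuous f by move=> /funext ->.
have MRe i j u : complex.Re (M u i j) = u (Some (i, j, true)) + u (Some (j, i, true)).
  by rewrite !mxE cReD cReJ.
have MIm i j u : complex.Im (M u i j) = u (Some (i, j, false)) - u (Some (j, i, false)).
  by rewrite !mxE cImD cImJ.
have Mherm u : (M u) ^t* = M u by rewrite /M adjD trmxCK addrC.
clearbody M.
have cadd (f g : X -> R) : continuous f -> continuous g -> continuous (fun u : X => f u + g u).
  by move=> cf cg u; exact: (cvgD (cf u) (cg u)).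
have csub (f g : X -> R) : continuous f -> continuous g -> continuous (fun u : X => f u - g u).
  by move=> cf cg u; exact: (cvgB (cf u) (cg u)).
have cmul (f g : X -> R) : continuous f -> continuous g -> continuous (fun u : X => f u * g u).
  by move=> cf cg u; exact: (cvgM (cf u) (cg u)).
have ccst (a : R) : continuous (fun _ : X => a).
  exact: (@cst_continuous X R a).
have cReE i j : continuous (fun u : X => complex.Re (M u i j)).
  by apply: (cext _ (fun u => u (Some (i, j, true)) + u (Some (j, i, true)))) => //;
    exact: cadd.
have cImE i j : continuous (fun u : X => complex.Im (M u i j)).
  by apply: (cext _ (fun u => u (Some (i, j, false)) - u (Some (j, i, false)))) => //;
    exact: csub.
have csum (J : finType) (f : J -> X -> R) : (forall j, continuous (f j)) ->
    continuous (fun u : X => \sum_j f j u).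
  move=> cf; apply: continuous_big => //.
  by move=> [a b]; exact: add_continuous.
have clin (a b : 'I_k -> 'I_k -> R) : continuous (fun u : X => \sum_i \sum_j
   (complex.Re (M u i j) * a i j - complex.Im (M u i j) * b i j)).
  apply: (csum) => i; apply: (csum) => j.
  by apply: csub; apply: cmul => //; exact: ccst.
have cF x : continuous (fun u : X => complex.Re (qf (F (M u)) x x)).
  apply: cext (clin (fun i j => complex.Re (qf (F (delta_mx i j)) x x))
                    (fun i j => complex.Im (qf (F (delta_mx i j)) x x))) => u.
  by rewrite qf_linearE.
have cI x : continuous (fun u : X => complex.Re (qf (M u) x x)).
  apply: cext (clin (fun i j => complex.Re (qf (delta_mx i j) x x))
                    (fun i j => complex.Im (qf (delta_mx i j) x x))) => u.
  by rewrite qf_entriesE.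
have cT : continuous (fun u : X => trRe (M u)).
  apply: (cext _ (fun u => \sum_i complex.Re (M u i i))); last by apply: csum => i; exact: cReE.
  by move=> u; rewrite /trRe /mxtrace cRe_sum.
have cD x : continuous (fun u : X => complex.Re (qf (F (M u) - (u None)%:C%C *: M u) x x)).
  apply: (cext _ (fun u : X =>
    complex.Re (qf (F (M u)) x x) - u None * complex.Re (qf (M u) x x))).
    by move=> u; rewrite qfBm cReD cReN qfZm cReZ.
  by apply: csub => //; apply: cmul.
have clS : closed S.
  have -> : S = (fun u : X => trRe (M u)) @^-1` [set x | x = 1] `&`
     (\bigcap_x (fun u : X => complex.Re (qf (M u) x x)) @^-1` [set y | 0 <= y]) `&`
     (\bigcap_x (fun u : X =>
       complex.Re (qf (F (M u) - (u None)%:C%C *: M u) x x)) @^-1` [set y | 0 <= y]).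
    apply/seteqP; split=> u /=; first by move=> [h1 h2 h3]; split; [split=> // x _;
      exact: h2|move=> x _; exact: h3].
    by move=> [[h1 h2] h3]; split=> // x; [exact: h2|exact: h3].
  apply: closedI; first apply: closedI.
  - by apply: preimage_closed => [u _|]; [exact: cT|exact: closed_eq].
  - by apply: closed_bigI => x _; apply: preimage_closed => [u _|];
    [exact: cI|exact: closed_ge].
  - by apply: closed_bigI => x _; apply: preimage_closed => [u _|];
    [exact: cD|exact: closed_ge].
have SM u : S u -> psd (M u) /\ psd (F (M u) - (u None)%:C%C *: M u).
  move=> [_ h1 h2]; have p1 : psd (M u) by [].
  split=> //; split=> //.
  by rewrite adjD adjN adjZ (psd_herm (F_psd p1)) Mherm conj_Creal // complex_real.
have MS A t : psd A -> trRe A = 1 -> 0 <= t -> psd (F A - t%:C%C *: A) ->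
   exists2 u, (K `&` S) u & u None = t /\ M u = A.
  move=> pA tA t0 pD.
  pose u : X := fun i => if i is Some (i, j, b) then
    (if b then complex.Re (A i j) else complex.Im (A i j)) / 2 else t.
  have MuA : M u = A.
    have hA i j : A j i = (A i j)^* by rewrite -[in LHS](psd_herm pA) !mxE.
    apply/matrixP => i j; apply: complexP; rewrite ?MRe ?MIm /= (hA i j) ?cReJ ?cImJ.
      by rewrite -splitr.
    by rewrite mulNr opprK -splitr.
  have tc : t <= c.
    have := trRe_psd_ge0 pD; rewrite trReB trReZ tA mulr1 => h.
    by rewrite (le_trans _ (hc A pA tA)) // -subr_ge0.
  exists u => //; split; last by split; rewrite MuA //; [exact: psd_ge0|exact: psd_ge0].
  move=> [[[i j] b]|]; rewrite /= in_itv /=; last by rewrite t0.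
  have [h1 h2] := psd_entry_bound i j pA; rewrite tA !ler_norml in h1 h2.
  by case: b; [move: h1|move: h2] => /andP[? ?]; apply/andP; split; lra.
have [u0 Su0] : K `&` S !=set0.
  have k0 : (0 : R) < k%:R by rewrite ltr0n.
  have p1 : psd (((k%:R : R)^-1)%:C%C *: 1%:M : 'M[C]_k).
    apply: psdZ; first by rewrite invr_ge0 ltW.
    by rewrite -[1%:M]mulmx1 -{2}adj1; exact: psd_mulBB.
  have [|||u h _] := MS _ 0 p1; last by exists u.
  - by rewrite trReZ trRe1 mulVf // gt_eqF.
  - by [].
  - by rewrite scale0r subr0; exact: F_psd.
have [|||u /set_mem[Ku Su] umax] := @compact_EVT_max _ _ (fun u : X => u None) (K `&` S).
- by exists u0.
- exact: compact_closedI.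
- by apply: continuous_subspaceT; exact: cpr.
have [p1 p2] := SM _ Su.
exists (u None), (M u); split => //.
- by have := Ku None; rewrite /= in_itv /= => /andP[].
- by have [] := Su.
- move=> t A t0 pA tA h; have [v KSv [<- _]] := MS A t pA tA t0 h.
  exact/umax/mem_set.
Qed.
End PF.

Section PF2.
Context {R : realType} {k : nat}.
Local Notation C := R[i].

Lemma posdef_tr_gt0 (A : 'M[C]_k) : (0 < k)%N -> posdefmx A -> 0 < trRe A.
Proof.
move=> k0 pA; have p := posdef_psd pA.
rewrite lt_neqAle trRe_psd_ge0 // andbT eq_sym; apply/negP => /eqP/(psd_trRe_eq0 p) h.
have /posdefP[_ /(_ (delta_mx (Ordinal k0) 0))] := pA.
rewrite qf_delta h mxE ltxx => f; suff: false by []; apply: f; apply/eqP =>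
  /matrixP/(_ (Ordinal k0) 0)/eqP.
by rewrite !mxE !eqxx oner_eq0.
Qed.

(** If the maximiser [rho] had a nonzero defect F rho - r rho, iterating 1 + F would make the defect
    positive definite, and r could be increased. So [rho] is an eigenvector, and irreducibility
    makes it positive definite. *)
Lemma perron_frobenius (F : {linear 'M[C]_k -> 'M[C]_k}) : (0 < k)%N ->
  (forall A, psd A -> psd (F A)) ->
  (forall Y, psd Y -> Y != 0 ->
    (forall x : 'cV_k, Y *m x = 0 -> F Y *m x = 0) -> posdefmx Y) ->
  exists (r : R) (rho : 'M[C]_k),
    [/\ 0 <= r, posdefmx rho, F rho = r%:C%C *: rho & \tr rho = 1].
Proof.
move=> k0 Fp Firr.
have [r [rho [r0 prho trrho pD rmax]]] := collatz_wielandt_max k0 Fp.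
have rho0 : rho != 0.
  by apply: contra_eq_neq trrho => ->; rewrite /trRe mxtrace0 eq_sym oner_eq0.
have [D0|D0] := eqVneq (F rho - r%:C%C *: rho) 0.
  have Frho : F rho = r%:C%C *: rho by apply/eqP; rewrite -subr_eq0 D0.
  exists r, rho; split=> //.
    by apply: Firr => // x h; rewrite Frho -scalemxAl h scaler0.
  by rewrite herm_tr ?trrho //; exact: psd_herm.
have [n pn] := iter_step_posdef Fp Firr pD D0.
rewrite iter_step_sub in pn.
set A := iter n _ rho in pn.
have pA : psd A by exact: iter_step_psd.
clearbody A.
have trA : 0 < trRe A.
  rewrite lt_neqAle trRe_psd_ge0 // andbT eq_sym; apply/negP => /eqP/psd_trRe_eq0 h.
  have := posdef_tr_gt0 k0 pn.
  by rewrite h // linear0 scaler0 subr0 /trRe mxtrace0 ltxx.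
(* The normalised iterate [A] then satisfies the constraint with r + e, against the maximality of
   r. *)
have [e e0 pe] := posdef_dominates pn (psd_herm pA).
have := rmax (r + e) ((trRe A)^-1%:C%C *: A).
have tr0 : 0 <= (trRe A)^-1 by rewrite invr_ge0 ltW.
rewrite addr_ge0 ?(ltW e0) // trReZ mulVf ?gt_eqF // => /(_ isT) h.
have : r + e <= r; last by rewrite gerDl leNgt e0.
apply: h => //; first exact: psdZ.
rewrite linearZ /= scalerA (mulrC (r + e)%:C%C) -scalerA -scalerBr.
apply: psdZ; first exact: tr0.
by rewrite rmorphD /= scalerDl opprD addrA.
Qed.

(* The least t in the hypothesis on A is a norm of A which F multiplies by at
   most r, so an eigenvalue cannot have modulus above r. *)
Lemma spectral_radiusE (F : {linear 'M[C]_k -> 'M[C]_k}) (r : R) rho :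
  (0 < k)%N -> 0 <= r -> posdefmx rho -> F rho = r%:C%C *: rho ->
  (forall A t, 0 <= t ->
    (forall x y, complex.Re (qf A x y) <=
       t * (complex.Re (qf rho x x) + complex.Re (qf rho y y))) ->
    (forall x y, complex.Re (qf (F A) x y) <=
       t * (complex.Re (qf (F rho) x x) + complex.Re (qf (F rho) y y)))) ->
  spectral_radius F = r.
Proof.
move=> k0 r0 prho Frho Fdom.
pose w x y := complex.Re (qf rho x x) + complex.Re (qf rho y y).
have qp x : 0 <= complex.Re (qf rho x x) by apply: psd_ge0; exact: posdef_psd.
have w0 x y : 0 <= w x y by rewrite addr_ge0.
have cnorm (c : C) : `|c| = (complex.Re `|c|)%:C%C by rewrite RRe_real // normr_real.
have cn0 (c : C) : 0 <= complex.Re `|c| by rewrite -ler0c -cnorm.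
rewrite /spectral_radius; set S := (X in sup X).
have rS : S r.
  exists r%:C%C; last by rewrite ger0_norm ?ler0c.
  exists rho => //; apply: contraTneq (posdef_tr_gt0 k0 prho) => ->.
  by rewrite /trRe mxtrace0 ltxx.
have Sle s : S s -> s <= r.
  move=> [c [A A0 FA] <-]; rewrite leNgt; apply/negP => rc.
  set m := complex.Re `|c| in rc.
  have m0 : 0 < m by exact: le_lt_trans rc.
  pose T := [set t : R | 0 <= t /\ forall x y, complex.Re (qf A x y) <= t * w x y].
  have T0 : T !=set0.
    have [a a0 ha] := form_bound A; have [b b0 hb] := posdef_lower prho.
    exists (a * b); split=> [|x y]; first by rewrite mulr_ge0 // ltW.
    apply: le_trans (ler_norm _) _; apply: le_trans (ha x y) _.
    by rewrite -mulrA ler_wpM2l ?(ltW a0) // /w mulrDr lerD.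
  have Tinf : has_inf T by split => //; exists 0 => t [].
  pose t := inf T.
  have t0 : 0 <= t by apply: lb_le_inf => // u [].
  have tT : T t.
    split=> // x y; have [w1|w1] := eqVneq (w x y) 0.
      by have [u [_ /(_ x y)]] := T0; rewrite w1 !mulr0.
    have wp : 0 < w x y by rewrite lt_neqAle eq_sym w1 w0.
    rewrite -ler_pdivrMr //; apply: lb_le_inf => // u [_ /(_ x y)].
    by rewrite ler_pdivrMr.
  have tr : T (t * (r / m)).
    split=> [|x y]; first by rewrite mulr_ge0 // divr_ge0 // ltW.
    (* The phase of c: rotating x by it replaces c by its modulus on the left and leaves the
       diagonal values of the form of [rho] unchanged. *)
    pose om := (c^* / `|c|)^*.
    have c0 : c != 0 by apply/eqP => c0; move: m0; rewrite /m c0 normr0 /= ltxx.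
    have n0 : `|c| != 0 by rewrite normr_eq0.
    have omE : om * om^* = 1.
      rewrite /om conjCK rmorphM /= conjCK fmorphV /= conj_Creal ?normr_real //.
      by rewrite mulrACA -normCK -invfM -expr2 mulfV // expf_neq0.
    have := Fdom A t t0 tT.2 (om *: x) y.
    rewrite FA qfZm qfZl mulrA Frho !qfZm !qfZl !qfZr !cReZ.
    rewrite !(mulrA om^*) (mulrC om^*) omE mul1r.
    have -> : c * om^* = m%:C%C.
      by rewrite /om conjCK mulrA -normCK expr2 mulfK // -cnorm.
    rewrite cReZ -mulrDr -/(w x y) => h.
    by rewrite -(ler_pM2l m0) (le_trans h) // le_eqVlt; apply/orP; left; apply/eqP; field;
      rewrite gt_eqF.
  have tle : t <= t * (r / m) by apply: ge_inf => //; exact: Tinf.2.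
  have tz : t = 0.
    apply/eqP; rewrite eq_le t0 andbT leNgt; apply/negP => tp.
    by move: tle; rewrite -[leLHS]mulr1 ler_pM2l // ler_pdivlMr // mul1r leNgt rc.
  have Az x y : complex.Re (qf A x y) = 0.
    apply/eqP; rewrite eq_le; have [_ h] := tT; rewrite tz in h.
    have := h x y; have := h (-1 *: x) y; rewrite !mul0r qfZl rmorphN rmorph1 mulN1r cReN.
    by rewrite oppr_le0 => -> ->.
  case/eqP: A0; apply/matrixP => i j; rewrite mxE -qf_delta; apply: complexP; first exact: Az.
  have := Az (delta_mx i 0) (- 'i%C *: delta_mx j 0); rewrite qfZr mulNr.
  by case: (qf _ _ _) => p q /= ; lra.
apply/eqP; rewrite eq_le; apply/andP; split.
  by apply: ge_sup; [exists r|exact: Sle].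
by apply: ub_le_sup => //; exists r; exact: Sle.
Qed.

End PF2.

(** * Measurability and integration of matrix-valued functions *)

Lemma complex_lipschitz_continuous (R : realType) (f : R[i] -> R) :
  (forall x y, `|f x - f y|%:C%C <= `|x - y|) -> continuous (f : R[i]^o -> R).
Proof.
move=> hf x.
have FF : Filter (nbhs (x : R[i]^o)) by exact: nbhs_filter.
have h := @cvgrPdist_lt R R^o R[i]^o (nbhs (x : R[i]^o)) FF f (f x).
apply: h.2 => e e0.
have e1 : 0 < e%:C%C :> R[i] by rewrite ltcR.
have := @cvgr_dist_lt _ (R[i]^o) _ _ FF id x (@cvg_id _ (nbhs (x : R[i]^o))) _ e1.
apply: filterS => y /= lt_e.
by have := le_lt_trans (hf x y) lt_e; rewrite ltcR.
Qed.

Lemma Re_continuous (R : realType) : continuous (fun x : R[i]^o => complex.Re x).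
Proof.
apply: (@complex_lipschitz_continuous _ (@complex.Re R)) => x y.
by have := normc_ge_Re (x - y); rewrite cReD cReN.
Qed.

Lemma Im_continuous (R : realType) : continuous (fun x : R[i]^o => complex.Im x).
Proof.
apply: (@complex_lipschitz_continuous _ (@complex.Im R)) => x y.
have := normc_ge_Re ('i%C * (x - y)).
have -> : complex.Re ('i%C * (x - y)) = - (complex.Im x - complex.Im y).
  by rewrite cReM /= mul0r sub0r mul1r cImD cImN.
rewrite normrN normrM; have -> : `|'i%C| = 1 :> R[i].
  by rewrite normc_def /= expr0n /= add0r expr1n sqrtr1.
by rewrite mul1r.
Qed.

(** Traces of products of [L v], its adjoint and constant matrices are polynomials in these real
    functions, which makes their measurability routine. *)
Definition entries_measurable d (T : measurableType d) (R : realType) k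
    (L : T -> 'M[R[i]]_k) : Prop :=
  forall i j, measurable_fun setT (fun v => complex.Re (L v i j)) /\
              measurable_fun setT (fun v => complex.Im (L v i j)).

Lemma measurable_borelM (R : realType) k (f : borelM R k -> R) :
  continuous (f : 'M[R[i]^o]_k -> R) -> measurable_fun setT f.
Proof.
move=> /continuousP cf; apply: (measurability _ (RGenOpens.measurableE R)).
move=> _ [_ [a [b ->] <-]]; rewrite setTI; apply: sub_sigma_algebra.
exact/cf/interval_open.
Qed.

Lemma measurableM_entries (R : realType) k (L : borelM R k -> 'M[R[i]]_k) :
  measurableM L -> entries_measurable L.
Proof.
move=> mL i j; split.
- pose f (A : 'M[R[i]^o]_k) := complex.Re (A i j).
  have cf : continuous f.
    move=> A; apply: (@continuous_comp _ _ _ (fun A : 'M[R[i]^o]_k =>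
      A i j) (fun x : R[i]^o => complex.Re x)).
      exact: coord_continuous.
    exact: Re_continuous.
  exact: (measurableT_comp (measurable_borelM cf) mL).
- pose f (A : 'M[R[i]^o]_k) := complex.Im (A i j).
  have cf : continuous f.
    move=> A; apply: (@continuous_comp _ _ _ (fun A : 'M[R[i]^o]_k =>
      A i j) (fun x : R[i]^o => complex.Im x)).
      exact: coord_continuous.
    exact: Im_continuous.
  exact: (measurableT_comp (measurable_borelM cf) mL).
Qed.

Section cintegrable.
Context d (T : measurableType d) (R : realType) (mu : {measure set T -> \bar R}).
Local Notation C := R[i].
Implicit Types f g : T -> C.

Definition cintegrable f : Prop :=
  mu.-integrable setT (fun x => (complex.Re (f x))%:E) /\
  mu.-integrable setT (fun x => (complex.Im (f x))%:E).

Lemma integrableDR (u v : T -> R) : mu.-integrable setT (EFin \o u) ->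
  mu.-integrable setT (EFin \o v) -> mu.-integrable setT (EFin \o (fun x => u x + v x)).
Proof.
move=> iu iv; apply: eq_integrable (integrableD _ iu iv) => // x _ /=.
Qed.

Lemma integrableBR (u v : T -> R) : mu.-integrable setT (EFin \o u) ->
  mu.-integrable setT (EFin \o v) -> mu.-integrable setT (EFin \o (fun x => u x - v x)).
Proof.
move=> iu iv; apply: eq_integrable (integrableB _ iu iv) => // x _ /=.
Qed.

Lemma integrableZR a (u : T -> R) : mu.-integrable setT (EFin \o u) ->
  mu.-integrable setT (EFin \o (fun x => a * u x)).
Proof.
move=> iu; apply: eq_integrable (integrableZl _ a iu) => // x _ /=.
Qed.

Lemma cintegrable0 : cintegrable (fun=> 0).
Proof. by split; exact: integrable0. Qed.

Lemma cintegrableD f g : cintegrable f -> cintegrable g ->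
  cintegrable (fun x => f x + g x).
Proof.
move=> [f1 f2] [g1 g2]; split.
- by apply: eq_integrable (integrableDR f1 g1) => // x _ /=; rewrite cReD.
- by apply: eq_integrable (integrableDR f2 g2) => // x _ /=; rewrite cImD.
Qed.

Lemma cintegrableZ c f : cintegrable f -> cintegrable (fun x => c * f x).
Proof.
move=> [f1 f2]; split.
- apply: eq_integrable (integrableBR (integrableZR (complex.Re c) f1) (integrableZR (complex.Im c) f2)) => // x _ /=.
  by rewrite cReM.
- apply: eq_integrable (integrableDR (integrableZR (complex.Re c) f2) (integrableZR (complex.Im c) f1)) => // x _ /=.
  by rewrite cImM.
Qed.

Lemma cintegrable_sum (I : finType) (f : I -> T -> C) :
  (forall i, cintegrable (f i)) -> cintegrable (fun x => \sum_i f i x).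
Proof.
move=> cf; elim: (index_enum I) => [|i s ih].
  by under [fun x => _]funext do rewrite big_nil; exact: cintegrable0.
by under [fun x => _]funext do rewrite big_cons; exact: cintegrableD.
Qed.

Lemma cintegral0 : cintegral mu (fun=> 0) = 0.
Proof. by rewrite /cintegral /= !Rintegral_cst // !mul0r. Qed.

Lemma cintegralD f g : cintegrable f -> cintegrable g ->
  cintegral mu (fun x => f x + g x) = cintegral mu f + cintegral mu g.
Proof.
move=> [f1 f2] [g1 g2]; apply: complexP; rewrite ?cReD ?cImD /= -RintegralD //.
- by apply: eq_Rintegral => x _; rewrite cReD.
- by apply: eq_Rintegral => x _; rewrite cImD.
Qed.

Lemma cintegralZ c f : cintegrable f ->
  cintegral mu (fun x => c * f x) = c * cintegral mu f.
Proof.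
move=> [f1 f2]; apply: complexP; rewrite ?cReM ?cImM /= -!RintegralZl //.
- rewrite -RintegralB //; [|exact: integrableZR..].
  by apply: eq_Rintegral => x _; rewrite cReM.
- rewrite -RintegralD //; [|exact: integrableZR..].
  by apply: eq_Rintegral => x _; rewrite cImM.
Qed.

Lemma cintegral_sum (I : finType) (f : I -> T -> C) :
  (forall i, cintegrable (f i)) ->
  cintegral mu (fun x => \sum_i f i x) = \sum_i cintegral mu (f i).
Proof.
move=> cf.
suff [] : cintegrable (fun x => \sum_i f i x) /\
  cintegral mu (fun x => \sum_i f i x) = \sum_i cintegral mu (f i) by [].
elim: (index_enum I) => [|i s [ih1 ih2]].
  under [fun x => _]funext do rewrite big_nil.
  by rewrite big_nil; split; [exact: cintegrable0|exact: cintegral0].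
under [fun x => _]funext do rewrite big_cons.
by rewrite big_cons cintegralD // ih2; split => //; exact: cintegrableD.
Qed.

End cintegrable.

Section HSnorm.
Context {R : realType} {k : nat}.
Local Notation C := R[i].
Implicit Types (A B : 'M[C]_k).

Lemma HSnorm_sq A : HSnorm A ^+ 2 = trRe (A *m A ^t*).
Proof. by rewrite sqr_sqrtr //; apply: trRe_psd_ge0; exact: psd_mulBB. Qed.

Lemma HSnorm_adj A : HSnorm (A ^t*) ^+ 2 = HSnorm A ^+ 2.
Proof. by rewrite !HSnorm_sq trmxCK /trRe mxtrace_mulC. Qed.

Lemma HSnorm_eq0 A : HSnorm A ^+ 2 = 0 -> A = 0.
Proof. by rewrite HSnorm_sq => /trRe_BB_eq0. Qed.

Lemma entry_le_HSnorm A i j :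
  complex.Re (A i j) ^+ 2 + complex.Im (A i j) ^+ 2 <= HSnorm A ^+ 2.
Proof.
have s0 a b : 0 <= complex.Re (A a b) ^+ 2 + complex.Im (A a b) ^+ 2.
  by rewrite addr_ge0 // sqr_ge0.
rewrite HSnorm_sq trRe_BB (bigD1 i) //= (bigD1 j) //= -addrA lerDl.
by rewrite addr_ge0 //; apply: sumr_ge0 => // a _; apply: sumr_ge0.
Qed.

Lemma tr_deltaM A i j : \tr (delta_mx j i *m A) = A i j.
Proof.
rewrite /mxtrace (bigD1 j) //= mxE (bigD1 i) //= !mxE !eqxx mul1r big1 => [|l li].
  rewrite addr0 big1 ?addr0 // => l lj; rewrite mxE big1 // => m _.
  by rewrite mxE (negbTE lj) mul0r.
by rewrite mxE (negbTE li) andbF mul0r.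
Qed.

Lemma qf_tr A (x y : 'cV[C]_k) : qf A x y = \tr (y *m x ^t* *m A).
Proof.
rewrite -mulmxA mxtrace_mulC /qf /mxtrace big_ord_recl big_ord0 addr0.
by [].
Qed.
End HSnorm.

Lemma measurable_HSnorm d (T : measurableType d) (R : realType) k
    (L : T -> 'M[R[i]]_k) : entries_measurable L ->
  measurable_fun setT (fun v => HSnorm (L v) ^+ 2).
Proof.
move=> mL; under [fun v => _]funext do rewrite HSnorm_sq trRe_BB.
apply: measurable_sum => i; apply: measurable_sum => j.
by apply: measurable_funD; apply: measurable_funX; apply mL.
Qed.

Lemma entries_measurable_adj d (T : measurableType d) (R : realType) k
    (L : T -> 'M[R[i]]_k) : entries_measurable L ->
  entries_measurable (fun v => (L v) ^t*).
Proof.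
move=> mL i j; split.
- under [fun v => _]funext do rewrite !mxE cReJ; exact: (mL j i).1.
- under [fun v => _]funext do rewrite !mxE cImJ.
  by apply: measurable_funN; exact: (mL j i).2.
Qed.

Section phi.
Context {R : realType} {k : nat} (mu : {measure set (borelM R k) -> \bar R}).
Local Notation C := R[i].
Local Notation T := (borelM R k).
Implicit Types (A B M : 'M[C]_k) (L : T -> 'M[C]_k).

Definition admissible L : Prop := entries_measurable L /\ square_integrable mu L.

Lemma admissible_adj L : admissible L -> admissible (fun v => (L v) ^t*).
Proof.
move=> [mL iL]; split; first exact: entries_measurable_adj.
by rewrite /square_integrable; under eq_integral do rewrite HSnorm_adj.
Qed.

(** Lets one theory of [phi] serve both operators, since [admissible] is stable under adjoints. *)
Lemma phi_starE L : phi_star mu L = phi mu (fun v => (L v) ^t*).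
Proof.
apply/funext => A; apply/matrixP => i j; rewrite !mxE; congr cintegral.
by apply/funext => v; rewrite trmxCK.
Qed.

Lemma integrable_HSnorm L : admissible L -> mu.-integrable setT (EFin \o (fun v =>
  HSnorm (L v) ^+ 2)).
Proof.
move=> [mL iL]; apply/integrableP; split.
  by apply/measurable_EFinP; exact: measurable_HSnorm.
by under eq_integral do rewrite gee0_abs ?lee_fin ?sqr_ge0 //.
Qed.

Lemma integrable_entry_prod L (f g : T -> R) : admissible L ->
  measurable_fun setT f -> measurable_fun setT g ->
  (forall v, f v ^+ 2 <= HSnorm (L v) ^+ 2) -> (forall v, g v ^+ 2 <= HSnorm (L v) ^+ 2) ->
  mu.-integrable setT (EFin \o (fun v => f v * g v)).
Proof.
move=> gL mf mg hf hg; apply: le_integrable (integrable_HSnorm gL) => //.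
  by apply/measurable_EFinP; exact: measurable_funM.
move=> v _; rewrite /= lee_fin [leRHS]ger0_norm ?sqr_ge0 // normrM.
rewrite -[leRHS]sqr_sqrtr ?sqr_ge0 // expr2 ler_pM //.
- by rewrite -sqrtr_sqr ler_wsqrtr.
- by rewrite -sqrtr_sqr ler_wsqrtr.
Qed.

Lemma cintegrable_entries L a b c d : admissible L ->
  cintegrable mu (fun v => L v a b * (L v c d)^*).
Proof.
move=> gL; have mL := gL.1.
have Re_le i j v : complex.Re (L v i j) ^+ 2 <= HSnorm (L v) ^+ 2.
  by rewrite (le_trans _ (entry_le_HSnorm (L v) i j)) // lerDl sqr_ge0.
have Im_le i j v : complex.Im (L v i j) ^+ 2 <= HSnorm (L v) ^+ 2.
  by rewrite (le_trans _ (entry_le_HSnorm (L v) i j)) // lerDr sqr_ge0.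
split.
- apply: (eq_integrable _ (EFin \o (fun v => complex.Re (L v a b) * complex.Re (L v c d)
     + complex.Im (L v a b) * complex.Im (L v c d)))) => //.
    by move=> v _ /=; rewrite cReM cReJ cImJ mulrN opprK.
  by apply: integrableDR; apply: integrable_entry_prod gL _ _ _ _ => //; apply mL.
- apply: (eq_integrable _ (EFin \o (fun v => complex.Im (L v a b) * complex.Re (L v c d)
     - complex.Re (L v a b) * complex.Im (L v c d)))) => //.
    by move=> v _ /=; rewrite cImM cReJ cImJ mulrN addrC.
  by apply: integrableBR; apply: integrable_entry_prod gL _ _ _ _ => //; apply mL.
Qed.

Lemma sandwichE L M v i j : (L v *m M *m (L v) ^t*) i j =
  \sum_a \sum_b M b a * (L v i b * (L v j a)^*).
Proof.
rewrite mxE; apply: eq_bigr => a _; rewrite mxE mulr_suml; apply: eq_bigr => b _.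
by rewrite !mxE mulrAC mulrC.
Qed.

Lemma cintegrable_sandwich L M i j : admissible L ->
  cintegrable mu (fun v => (L v *m M *m (L v) ^t*) i j).
Proof.
move=> gL; under [fun v => _]funext do rewrite sandwichE.
apply: cintegrable_sum => a; apply: cintegrable_sum => b.
by apply: cintegrableZ; exact: cintegrable_entries.
Qed.

Lemma tr_mulE A B : \tr (A *m B) = \sum_i \sum_j A i j * B j i.
Proof. by apply: eq_bigr => i _; rewrite mxE. Qed.

Lemma cintegrable_tr L A M : admissible L ->
  cintegrable mu (fun v => \tr (A *m (L v *m M *m (L v) ^t*))).
Proof.
move=> gL; under [fun v => _]funext do rewrite tr_mulE.
apply: cintegrable_sum => a; apply: cintegrable_sum => b.
by apply: cintegrableZ; exact: cintegrable_sandwich.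
Qed.

Lemma tr_phi L A M : admissible L -> \tr (A *m phi mu L M) =
  cintegral mu (fun v => \tr (A *m (L v *m M *m (L v) ^t*))).
Proof.
move=> gL; under [fun v => _]funext do rewrite tr_mulE.
rewrite tr_mulE cintegral_sum => [|i]; last first.
  by apply: cintegrable_sum => b; apply: cintegrableZ; exact: cintegrable_sandwich.
apply: eq_bigr => i _; rewrite cintegral_sum => [|j]; last first.
  by apply: cintegrableZ; exact: cintegrable_sandwich.
by apply: eq_bigr => j _; rewrite cintegralZ ?mxE //; exact: cintegrable_sandwich.
Qed.

Lemma phiE L M i j :
  phi mu L M i j = cintegral mu (fun v => (L v *m M *m (L v) ^t*) i j).
Proof. by rewrite mxE. Qed.

Opaque phi.

Lemma phi_is_linear L : admissible L -> linear (phi mu L).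
Proof.
move=> gL c A B; apply/matrixP => i j.
have iA := cintegrable_sandwich A i j gL; have iB := cintegrable_sandwich B i j gL.
have linE (X Y : 'M[C]_k) : (c *: X + Y) i j = c * X i j + Y i j by rewrite !mxE.
rewrite linE.
apply: (etrans (phiE L _ i j)); apply/esym.
apply: (etrans (congr2 (fun a b => c * a + b) (phiE L A i j) (phiE L B i j))).
rewrite -(cintegralZ c iA) -(cintegralD (cintegrableZ c iA) iB).
congr cintegral; apply/funext => v; apply/esym.
by rewrite mulmxDr mulmxDl -scalemxAr -scalemxAl linE.
Qed.

Lemma integrable_trRe L A M : admissible L ->
  mu.-integrable setT (EFin \o (fun v => trRe (A *m (L v *m M *m (L v) ^t*)))).
Proof. by move=> gL; exact: (cintegrable_tr A M gL).1. Qed.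

Lemma trRe_phi L A M : admissible L -> trRe (A *m phi mu L M) =
  \int[mu]_v trRe (A *m (L v *m M *m (L v) ^t*)).
Proof. by move=> gL; rewrite /trRe tr_phi. Qed.

Lemma Re_qfE A x y : complex.Re (qf A x y) = trRe (y *m x ^t* *m A).
Proof. by rewrite qf_tr. Qed.

Lemma integrable_qf L M x y : admissible L ->
  mu.-integrable setT (EFin \o (fun v => complex.Re (qf M ((L v) ^t* *m x) ((L v) ^t* *m y)))).
Proof.
move=> gL; apply: eq_integrable (integrable_trRe (y *m x ^t*) M gL) => // v _ /=.
by rewrite -Re_qfE qf_mul.
Qed.

Lemma Re_qf_phi L M x y : admissible L -> complex.Re (qf (phi mu L M) x y) =
  \int[mu]_v complex.Re (qf M ((L v) ^t* *m x) ((L v) ^t* *m y)).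
Proof.
move=> gL; rewrite Re_qfE trRe_phi //; apply: eq_Rintegral => v _.
by rewrite -Re_qfE qf_mul.
Qed.

Lemma phi_adj L M : admissible L -> (phi mu L M) ^t* = phi mu L (M ^t*).
Proof.
move=> gL; apply/matrixP => i j.
have adjE (X : 'M[C]_k) : (X ^t*) i j = (X j i)^* by rewrite !mxE.
rewrite adjE; apply: (etrans (congr1 (fun z => z^*) (phiE L M j i))).
apply/esym; apply: (etrans (phiE L _ i j)); apply/esym.
have [_ h] := cintegrable_sandwich M j i gL.
have E v : (L v *m M ^t* *m (L v) ^t*) i j = ((L v *m M *m (L v) ^t*) j i)^*.
  have -> : L v *m M ^t* *m (L v) ^t* = (L v *m M *m (L v) ^t*) ^t*.
    by rewrite !adjM trmxCK mulmxA.
  by rewrite !mxE.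
apply: complexP; rewrite ?cReJ ?cImJ /=.
  by apply: eq_Rintegral => v _; rewrite E cReJ.
rewrite -mulN1r -RintegralZl //; apply: eq_Rintegral => v _.
by rewrite E cImJ mulN1r.
Qed.

Lemma phi_psd L M : admissible L -> psd M -> psd (phi mu L M).
Proof.
move=> gL [hM pM]; split=> [|x]; first by rewrite phi_adj ?hM.
by rewrite Re_qf_phi //; apply: Rintegral_ge0 => v _.
Qed.

Lemma Rintegral_eq0_ae (f : T -> R) : mu.-integrable setT (EFin \o f) ->
  (forall v, 0 <= f v) -> \int[mu]_v f v = 0 -> {ae mu, forall v, f v = 0}.
Proof.
move=> fi f0 h.
have [mf _] := integrableP _ _ _ fi.
have : (\int[mu]_v `|(EFin \o f) v| = 0)%E.
  under eq_integral do rewrite gee0_abs ?lee_fin //.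
  by rewrite -[LHS]fineK ?integrable_fin_num // -[fine _]/(Rintegral mu setT f) h.
by move=> /(ae_eq_integral_abs mu measurableT mf); apply: filterS => v /(_ I) /= [].
Qed.

Lemma Rintegral_ae0 (f : T -> R) : measurable_fun setT f ->
  {ae mu, forall v, f v = 0} -> \int[mu]_v f v = 0.
Proof.
move=> mf h; rewrite /Rintegral (ae_eq_integral (cst 0%E)) ?integral0 //.
  exact/measurable_EFinP.
by apply: filterS h => v /= ->.
Qed.

Lemma mul_phi_ae0 L A M B : admissible L ->
  {ae mu, forall v, A *m (L v *m M *m (L v) ^t*) *m B = 0} -> A *m phi mu L M *m B = 0.
Proof.
move=> gL h; apply/matrixP => i j; rewrite [RHS]mxE -tr_deltaM mulmxA mxtrace_mulC !mulmxA.
rewrite tr_phi //; have [h1 h2] := cintegrable_tr (B *m delta_mx j i *m A) M gL.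
have E v : \tr (B *m delta_mx j i *m A *m (L v *m M *m (L v) ^t*)) =
    (A *m (L v *m M *m (L v) ^t*) *m B) i j.
  by rewrite -tr_deltaM [in RHS]mulmxA [RHS]mxtrace_mulC !mulmxA.
apply: complexP; apply: Rintegral_ae0.
- by apply/measurable_EFinP; exact: measurable_int h1.
- by apply: filterS h => v hv; rewrite E hv mxE.
- by apply/measurable_EFinP; exact: measurable_int h2.
- by apply: filterS h => v hv; rewrite E hv mxE.
Qed.
End phi.

(** * Perron-Frobenius data of the transfer operators *)

Section PFphi.
Context {R : realType} {k : nat} (mu : {measure set (borelM R k) -> \bar R}).
Local Notation C := R[i].
Local Notation T := (borelM R k).
Implicit Types (A B M Y P : 'M[C]_k) (L H : T -> 'M[C]_k).

Lemma hermitian_projectorC P : hermitian_projector P -> hermitian_projector (1%:M - P).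
Proof.
move=> [hP PP]; split; first by rewrite adjD adjN adj1 hP.
by rewrite mulmxBl mul1mx mulmxBr mulmx1 PP subrr subr0.
Qed.

(** When almost every L(v) maps the range of [P] into itself, multiplying phi (P A P) by [P] on
    either side does not change it, so it is its own witness for the inclusion in [irreducible]. *)
Lemma irreducible_proj L P : admissible mu L -> irreducible mu L -> hermitian_projector P ->
  {ae mu, forall v, (1%:M - P) *m L v *m P = 0} -> P = 0 \/ P = 1%:M.
Proof.
move=> gL iL hP h; apply: (iL P hP) => A; exists (phi mu L (P *m A *m P)).
have [hP1 PP] := hP.
have h1 : (1%:M - P) *m phi mu L (P *m A *m P) *m 1%:M = 0.
  apply: mul_phi_ae0 => //; apply: filterS h => v hv.
  by rewrite !mulmxA hv !mul0mx.
have h2 : 1%:M *m phi mu L (P *m A *m P) *m (1%:M - P) = 0.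
  apply: mul_phi_ae0 => //; apply: filterS h => v /(congr1 (fun X : 'M[C]_k => X ^t*)).
  rewrite !adjM adjD adjN adj1 hP1 adj0 => hv.
  by rewrite mul1mx -!mulmxA hv !mulmx0.
move: h1 h2; set X := phi mu L _; clearbody X;
  rewrite mul1mx mulmx1 mulmxBl mulmxBr mul1mx mulmx1.
move=> /eqP; rewrite subr_eq0 => /eqP h1 /eqP; rewrite subr_eq0 => /eqP h2.
by rewrite -h1.
Qed.

(** With Q = 1 - P, the kernel condition gives tr (Q phi Y) = 0. This is the integral of the squared
    norm of Q L(v) B, where Y = B adj(B), so the integrand vanishes almost everywhere. *)
Lemma phi_ker_ae L Y : admissible mu L -> psd Y ->
  (forall x : 'cV_k, Y *m x = 0 -> phi mu L Y *m x = 0) ->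
  exists P, [/\ hermitian_projector P, Y *m P = Y,
    {ae mu, forall v, (1%:M - P) *m L v *m P = 0} & exists Z, P = Z *m Y].
Proof.
move=> gL pY hker.
have [P [Z [hP YP PZ]]] := psd_support (psd_herm pY).
exists P; split=> //; last by exists Z.
have [hP1 PP] := hP.
set Q := 1%:M - P.
have hQ : Q ^t* = Q by have [] := hermitian_projectorC hP.
have YQ : Y *m Q = 0 by rewrite mulmxBr mulmx1 YP subrr.
have phiQ : phi mu L Y *m Q = 0.
  have colM (D E : 'M[C]_k) i : D *m col i E = col i (D *m E) by rewrite !colE mulmxA.
  have c0 i : col i (0 : 'M[C]_k) = 0 by apply/matrixP => a b; rewrite !mxE.
  apply/matrixP => i j; have := hker (col j Q); rewrite !colM YQ c0 => /(_ erefl).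
  by move=> /(congr1 (fun M : 'cV_k => M i 0)); rewrite !mxE.
have [B YB] := psd_factor pY.
have E v : trRe (Q *m (L v *m Y *m (L v) ^t*)) = trRe ((Q *m L v *m B) *m (Q *m L v *m B) ^t*).
  have QQ : Q *m Q = Q by have [] := hermitian_projectorC hP.
  rewrite YB !adjM hQ !mulmxA /trRe [in RHS]mxtrace_mulC !mulmxA QQ.
  by [].
have : \int[mu]_v trRe (Q *m (L v *m Y *m (L v) ^t*)) = 0.
  by rewrite -trRe_phi // /trRe mxtrace_mulC phiQ mxtrace0.
move=> /(Rintegral_eq0_ae (integrable_trRe Q Y gL)) h.
have {h} : {ae mu, forall v, trRe (Q *m (L v *m Y *m (L v) ^t*)) = 0}.
  by apply: h => v; rewrite E; apply: trRe_psd_ge0; exact: psd_mulBB.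
apply: filterS => v; rewrite E => /trRe_BB_eq0 h.
(* Factoring [P] through [Y], hence through [B], turns Q L(v) B = 0 into Q L(v) P = 0. *)
have -> : P = Y *m Z ^t* by rewrite -[LHS]hP1 PZ adjM (psd_herm pY).
by rewrite YB !mulmxA h !mul0mx.
Qed.

Lemma support1_posdef Y Z : psd Y -> 1%:M = Z *m Y -> posdefmx Y.
Proof.
move=> pY ZY; apply/posdefP; split=> [|x x0]; first exact: psd_herm.
rewrite lt_neqAle psd_ge0 // andbT eq_sym; apply: contra x0 => /eqP/(psd_ker pY) h.
by rewrite -[x]mul1mx ZY -mulmxA h mulmx0.
Qed.

Lemma phi_irr L Y : admissible mu L -> irreducible mu L -> psd Y -> Y != 0 ->
  (forall x : 'cV_k, Y *m x = 0 -> phi mu L Y *m x = 0) -> posdefmx Y.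
Proof.
move=> gL iL pY Y0 /(phi_ker_ae gL pY)[P [hP YP h [Z PZ]]].
have [P0|P1] := irreducible_proj gL iL hP h.
  by move/eqP: Y0; rewrite -YP P0 mulmx0.
by apply: (support1_posdef (Z := Z)) pY _; rewrite -P1.
Qed.

(** Adjunction turns stability of the range of P under adj(L(v)) into stability of the range of 1 -
    P under L(v), so the irreducibility of [L] itself applies. *)
Lemma phi_adj_irr L Y : admissible mu L -> irreducible mu L -> psd Y -> Y != 0 ->
  (forall x : 'cV_k, Y *m x = 0 -> phi mu (fun v => (L v) ^t*) Y *m x = 0) -> posdefmx Y.
Proof.
move=> gL iL pY Y0 /(phi_ker_ae (admissible_adj gL) pY)[P [hP YP h [Z PZ]]].
have hQ := hermitian_projectorC hP.
have [|Q0|Q1] := irreducible_proj gL iL hQ.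
- apply: filterS h => v /(congr1 (fun X : 'M[C]_k => X ^t*)).
  by rewrite !adjM trmxCK hQ.1 hP.1 adj0 mulmxA subKr.
- apply: (support1_posdef (Z := Z)) pY _; rewrite -PZ.
  by apply/eqP; rewrite -subr_eq0 Q0.
- have P0 : P = 0 by rewrite -[P](subKr 1%:M) Q1 subrr.
  by move/eqP: Y0; rewrite -YP P0 mulmx0.
Qed.

Definition phi_lin L (gL : admissible mu L) : {linear 'M[C]_k -> 'M[C]_k} :=
  HB.pack (phi mu L) (GRing.isLinear.Build _ _ _ _ (phi mu L) (phi_is_linear gL)).

Lemma phiZ L c A : admissible mu L -> phi mu L (c *: A) = c *: phi mu L A.
Proof.
move=> gL; have h : phi_lin gL (c *: A) = c *: phi_lin gL A by rewrite linearZ.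
exact: h.
Qed.

(** The order condition of [spectral_radiusE]: the bound is applied at the images of x and y under
    adj(L(v)) and integrated. *)
Lemma phi_dom L A M (t : R) : admissible mu L ->
  (forall x y, complex.Re (qf A x y) <= t * (complex.Re (qf M x x) + complex.Re (qf M y y))) ->
  forall x y, complex.Re (qf (phi mu L A) x y) <=
    t * (complex.Re (qf (phi mu L M) x x) + complex.Re (qf (phi mu L M) y y)).
Proof.
move=> gL h x y.
move: (Re_qf_phi A x y gL) (Re_qf_phi M x x gL) (Re_qf_phi M y y gL).
move: (phi mu L A) (phi mu L M) => F G.
move=> -> -> ->.
rewrite -RintegralD; [|by []|exact: (integrable_qf M x x gL)|exact: (integrable_qf M y y gL)].
have iD := integrableDR (integrable_qf M x x gL) (integrable_qf M y y gL).
rewrite -(RintegralZl t measurableT iD); apply: le_Rintegral;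
  [by []|exact: (integrable_qf A x y gL)|exact: integrableZR|by move=> v _; exact: h].
Qed.

Lemma trRe_mulBB (D E : 'M[C]_k) :
  trRe ((D *m D ^t*) *m (E *m E ^t*)) = trRe ((D ^t* *m E) *m (D ^t* *m E) ^t*).
Proof. by rewrite adjM trmxCK /trRe -(mulmxA D) mxtrace_mulC !mulmxA. Qed.

Lemma trRe_mul_ge0 A B : psd A -> psd B -> 0 <= trRe (A *m B).
Proof.
move=> /psd_factor[D ->] /psd_factor[E ->]; rewrite trRe_mulBB.
by apply: trRe_psd_ge0; exact: psd_mulBB.
Qed.

Lemma trRe_mul_eq0 A B : posdefmx A -> psd B -> trRe (A *m B) = 0 -> B = 0.
Proof.
move=> /posdef_factor[D -> uD] /psd_factor[E ->].
rewrite trRe_mulBB => /trRe_BB_eq0 h.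
have uD' : D ^t* \in unitmx by rewrite map_unitmx unitmx_tr.
by rewrite -[E](mulKmx uD') h mulmx0 mul0mx.
Qed.

Lemma trRe_mul_gt0 A B : posdefmx A -> psd B -> B != 0 -> 0 < trRe (A *m B).
Proof.
move=> pA pB B0; rewrite lt_neqAle trRe_mul_ge0 ?andbT //; last exact: posdef_psd.
by rewrite eq_sym; apply: contra B0 => /eqP/(trRe_mul_eq0 pA pB) ->.
Qed.

Lemma psd_conj A M : psd M -> psd (A *m M *m A ^t*).
Proof.
move=> /psd_factor[B ->]; rewrite !mulmxA -(mulmxA _ _ (A ^t*)) -adjM.
exact: psd_mulBB.
Qed.

Lemma trRe_mulC A B : trRe (A *m B) = trRe (B *m A).
Proof. by rewrite /trRe mxtrace_mulC. Qed.

Lemma trRe_phi_dual L A M : admissible mu L ->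
  trRe (A *m phi mu L M) = trRe (phi mu (fun v => (L v) ^t*) A *m M).
Proof.
move=> gL; apply: etrans (trRe_phi A M gL) _; apply/esym.
apply: etrans (trRe_mulC _ _) _; apply: etrans (trRe_phi M A (admissible_adj gL)) _.
apply: eq_Rintegral => v _; rewrite trmxCK /trRe; congr complex.Re.
by rewrite [RHS]mxtrace_mulC [in LHS]mulmxA [LHS]mxtrace_mulC !mulmxA.
Qed.

Hypothesis k_gt0 : (0 < k)%N.

Lemma posdef_neq0 A : posdefmx A -> A != 0.
Proof.
move=> /(posdef_tr_gt0 k_gt0); apply: contraTneq => ->.
by rewrite /trRe mxtrace0 ltxx.
Qed.

Lemma lambdaE L r rho : admissible mu L -> 0 <= r -> posdefmx rho ->
  phi mu L rho = r%:C%C *: rho -> lambda mu L = r.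
Proof.
move=> gL r0 prho h; apply: (@spectral_radiusE _ _ (phi_lin gL) r rho) => //.
by move=> A t _; exact: phi_dom.
Qed.

Lemma phi_perron L : admissible mu L -> irreducible mu L -> exists (r : R) rho sigma,
  [/\ 0 <= r, lambda mu L = r, [/\ posdefmx rho, phi mu L rho = r%:C%C *: rho & \tr rho = 1] &
      posdefmx sigma /\ phi mu (fun v => (L v) ^t*) sigma = r%:C%C *: sigma].
Proof.
move=> gL iL.
have [r [rho [r0 prho hrho trho]]] := @perron_frobenius _ _ (phi_lin gL) k_gt0
  (fun A => phi_psd gL (M := A)) (fun Y => phi_irr gL iL (Y := Y)).
have [s [sigma [s0 psigma hsigma _]]] :=
  @perron_frobenius _ _ (phi_lin (admissible_adj gL)) k_gt0
  (fun A => phi_psd (admissible_adj gL) (M := A)) (fun Y => phi_adj_irr gL iL (Y := Y)).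
have hr : phi mu L rho = r%:C%C *: rho := hrho.
have hs : phi mu (fun v => (L v) ^t*) sigma = s%:C%C *: sigma := hsigma.
(* Duality: tr (sigma phi rho) equals both r and s times the positive number tr (sigma rho). *)
have sr : s = r.
  have := trRe_phi_dual sigma rho gL; rewrite hr hs -scalemxAr -scalemxAl !trReZ.
  move=> /mulIf -> //; apply/lt0r_neq0/trRe_mul_gt0 => //; first exact: posdef_psd.
  exact: posdef_neq0.
exists r, rho, sigma; split=> //; first exact: (lambdaE gL r0 prho hr).
by rewrite hs sr.
Qed.

Lemma rhoM_spec L : admissible mu L -> irreducible mu L ->
  [/\ posdefmx (rhoM mu L), phi mu L (rhoM mu L) = (lambda mu L)%:C%C *: rhoM mu L
    & \tr (rhoM mu L) = 1].
Proof.
move=> gL iL; have [r [rho [sigma [r0 lr [h1 h2 h3] _]]]] := phi_perron gL iL.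
pose S : set 'M[C]_k := [set rho | [/\ posdefmx rho,
  phi mu L rho = (lambda mu L)%:C%C *: rho & \tr rho = 1]].
have : S !=set0 by exists rho; split=> //; rewrite lr.
by move=> /(xgetPex 0).
Qed.

Lemma sigmaM_spec L : admissible mu L -> irreducible mu L ->
  [/\ posdefmx (sigmaM mu L),
      phi mu (fun v => (L v) ^t*) (sigmaM mu L) = (lambda mu L)%:C%C *: sigmaM mu L
    & \tr (sigmaM mu L *m rhoM mu L) = 1].
Proof.
move=> gL iL; have [r [_ [sigma [r0 lr _ [ps hs]]]]] := phi_perron gL iL.
have [prho _ _] := rhoM_spec gL iL.
pose S : set 'M[C]_k := [set sigma | [/\ posdefmx sigma,
  phi_star mu L sigma = (lambda mu L)%:C%C *: sigma & \tr (sigma *m rhoM mu L) = 1]].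
rewrite -phi_starE; suff : S !=set0 by move=> /(xgetPex 0).
have t0 : 0 < trRe (sigma *m rhoM mu L).
  by apply: trRe_mul_gt0 => //; [exact: posdef_psd|exact: posdef_neq0].
have hsig : sigma ^t* = sigma by have [] := ps.
(* The normalisation in [sigmaM] is a complex equation. The trace is real because it is also that of
   the Hermitian matrix adj(B) sigma B. *)
have trE : \tr (sigma *m rhoM mu L) = (trRe (sigma *m rhoM mu L))%:C%C.
  have [B rB] := psd_factor (posdef_psd prho).
  have -> : \tr (sigma *m rhoM mu L) = \tr (B ^t* *m sigma *m B).
    by rewrite [in RHS]mxtrace_mulC mulmxA mxtrace_mulC rB.
  rewrite herm_tr; last by rewrite !adjM trmxCK hsig mulmxA.
  by rewrite /trRe [in LHS]mxtrace_mulC mulmxA mxtrace_mulC rB.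
exists ((trRe (sigma *m rhoM mu L))^-1%:C%C *: sigma); split.
- apply/posdefP; split; first by rewrite adjZ hsig conj_Creal // complex_real.
  move=> x x0; rewrite qfZm cReZ mulr_gt0 ?invr_gt0 //.
  by have /posdefP[_ h] := ps; exact: h.
- rewrite phi_starE lr.
  apply: etrans (phiZ _ _ (admissible_adj gL)) _.
  apply: etrans (congr1 (fun X => _ *: X) hs) _.
  by rewrite !scalerA mulrC.
- rewrite -scalemxAl mxtraceZ trE -rmorphM /= mulVf ?gt_eqF //.
Qed.

End PFphi.

(** * The variational upper bound *)

Section gibbs.
Context d (T : measurableType d) (R : realType).
Variable m : {sigma_finite_measure set T -> \bar R}.

(** Positive and negative parts are compared separately, since the integral on the left may be -oo
    when this is applied. *)
Lemma le_integral_of_ae_le (f g : T -> \bar R) : measurable_fun setT f ->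
  measurable_fun setT g -> {ae m, forall x, (f x <= g x)%E} ->
  (\int[m]_x f x <= \int[m]_x g x)%E.
Proof.
move=> mf mg fg; rewrite integralE [leRHS]integralE; apply: leeB.
- apply: ae_ge0_le_integral => //; [exact: measurable_funepos|exact: measurable_funepos|].
  by apply: filterS fg => x h _; rewrite !funeposE ge_max !le_max h lexx orbT.
- apply: ae_ge0_le_integral => //; [exact: measurable_funeneg|exact: measurable_funeneg|].
  by apply: filterS fg => x h _; rewrite !funenegE ge_max !le_max leeN2 h lexx orbT.
Qed.

(* ln x <= x - 1 at x = p / (l t); at t = 0 both logarithmic terms vanish. *)
Lemma gibbs_pointwise (q t p l : R) : 0 <= q -> 0 <= t -> 0 < p -> 0 < l ->
  q * t * ln p <= q * (t * ln t) + ln l * (q * t) + l^-1 * (q * p) - q * t.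
Proof.
move=> q0 t0 p0 l0.
suff h : t * ln p <= t * ln t + ln l * t + l^-1 * p - t.
  have := ler_wpM2l q0 h.
  have -> : q * (t * ln t + ln l * t + l^-1 * p - t) =
    q * (t * ln t) + ln l * (q * t) + l^-1 * (q * p) - q * t by ring.
  by apply: le_trans; rewrite mulrA.
have [->|t1] := eqVneq t 0.
  by rewrite !mul0r mulr0 !add0r subr0 mulr_ge0 // ?invr_ge0 ltW.
have tp : 0 < t by rewrite lt_neqAle eq_sym t1.
pose x := p / (l * t).
have x0 : 0 < x by rewrite divr_gt0 // mulr_gt0.
have h : ln x <= x - 1.
  have e : 1 + (x - 1) = x by rewrite addrC subrK.
  by rewrite -[in leLHS]e; apply: le_ln1Dx; rewrite ltrBrDr addNr.
have lnx : ln x = ln p - (ln l + ln t).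
  by rewrite /x ln_div ?posrE ?mulr_gt0 // lnM ?posrE.
rewrite lnx in h.
have -> : l^-1 * p = t * x.
  by rewrite /x; field; rewrite !gt_eqF.
have := ler_wpM2l t0 h; nra.
Qed.

Variables (q p : T -> R) (j t : T * T -> R) (l : R).
Hypothesis mq : measurable_fun setT q.
Hypothesis mp : measurable_fun setT p.
Hypothesis mj : measurable_fun setT j.
Hypothesis q0 : forall v, 0 <= q v.
Hypothesis p0 : forall v, 0 <= p v.
Hypothesis t0 : forall z, 0 <= t z.
Hypothesis jE : forall z, q z.1 * t z = j z.
Hypothesis l0 : 0 < l.
Hypothesis q1 : (\int[m]_v (q v)%:E = 1)%E.
Hypothesis pl : (\int[m]_v (p v)%:E = l%:E)%E.
Hypothesis j1 : forall v, (\int[m]_w (j (v, w))%:E = (q v)%:E)%E.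
Hypothesis j2 : forall w, (\int[m]_v (j (v, w))%:E = (q w)%:E)%E.
Hypothesis p_gt0 : {ae m, forall v, 0 < p v}.
Hypothesis ie : ((m \x m)%E).-integrable setT (fun z => (q z.1 * (t z * ln (t z)))%:E).

Let j0 z : 0 <= j z. Proof. by rewrite -jE mulr_ge0. Qed.

Let ij : ((m \x m)%E).-integrable setT (EFin \o j).
Proof.
apply/integrable12ltyP; first exact/measurable_EFinP.
under eq_integral => v _.
  under eq_integral do rewrite /= ger0_norm //.
  rewrite j1; over.
by rewrite q1 ltry.
Qed.

Let ej : (\int[(m \x m)%E]_z (j z)%:E = 1)%E.
Proof.
rewrite fubini_tonelli1 //; last exact/measurable_EFinP.
by rewrite /fubini_F; under eq_integral do rewrite j1.
Qed.

Let mqp : measurable_fun setT (fun z : T * T => q z.1 * p z.2).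
Proof.
apply: measurable_funM.
- exact: (measurableT_comp mq measurable_fst).
- exact: (measurableT_comp mp measurable_snd).
Qed.

Let eqp : (\int[(m \x m)%E]_z (q z.1 * p z.2)%:E = l%:E)%E.
Proof.
rewrite fubini_tonelli1 /=; last 2 first.
- exact/measurable_EFinP.
- by move=> z; rewrite lee_fin mulr_ge0.
rewrite /fubini_F /=.
under eq_integral => v _.
  under eq_integral do rewrite EFinM.
  rewrite ge0_integralZl_EFin //; [|by move=> w _; rewrite lee_fin|exact/measurable_EFinP].
  rewrite pl; over.
rewrite ge0_integralZr //; [|exact/measurable_EFinP|by move=> w _;
  rewrite lee_fin|by rewrite lee_fin ltW].
by rewrite q1 mul1e.
Qed.

Let iqp : ((m \x m)%E).-integrable setT (EFin \o (fun z : T * T => q z.1 * p z.2)).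
Proof.
apply/integrableP; split; first exact/measurable_EFinP.
under eq_integral do rewrite /= ger0_norm ?mulr_ge0 //.
by rewrite eqp ltry.
Qed.

(** The majorant of ln p(w) j(v,w) from [gibbs_pointwise]. In its integral the last two terms
    contribute 1 - 1, as q(v) p(w) has mass l and j has mass 1. *)
Let G z := q z.1 * (t z * ln (t z)) + ln l * j z + l^-1 * (q z.1 * p z.2) - j z.

Let iG : ((m \x m)%E).-integrable setT (EFin \o G).
Proof.
apply: integrableBR => //; apply: integrableDR; last exact: integrableZR.
by apply: integrableDR => //; exact: integrableZR.
Qed.

Let eG : (\int[(m \x m)%E]_z (G z)%:E =
  \int[(m \x m)%E]_z (q z.1 * (t z * ln (t z)))%:E + (ln l)%:E)%E.
Proof.
rewrite /G; under eq_integral do rewrite EFinB.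
rewrite integralB //; last first.
  by apply: integrableDR; [apply: integrableDR|] => //; exact: integrableZR.
under eq_integral do rewrite EFinD.
rewrite integralD //; [|by apply: integrableDR => //; exact: integrableZR|exact: integrableZR].
under eq_integral do rewrite EFinD.
rewrite integralD //; last exact: integrableZR.
under [X in (_ + X + _ - _)%E]eq_integral do rewrite EFinM.
under [X in (_ + _ + X - _)%E]eq_integral do rewrite EFinM.
rewrite !integralZl // ej eqp mule1 -[((l^-1)%:E * _)%E]EFinM mulVf ?gt_eqF //.
by rewrite -addeA subee // adde0.
Qed.

(** Here [t] stands for P_L and [l] for lambda_H. The marginal [j2] writes ln p(w) q(w) as the
    integral over v of ln p(w) j(v,w), which is compared with [G] for almost every w; only [G] has
    to be integrable on the product. *)
Lemma gibbs_variational :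
  ((- \int[(m \x m)%E]_z (q z.1 * (t z * ln (t z)))%:E)
    + \int[m]_v (ln (p v) * q v)%:E <= (ln l)%:E)%E.
Proof.
have fe : (\int[(m \x m)%E]_z (q z.1 * (t z * ln (t z)))%:E)%E \is a fin_num.
  exact: integrable_fin_num.
rewrite -leeBrDl // ?fin_numN // oppeK addeC -eG -(integral21_prod_meas1 iG).
apply: le_integral_of_ae_le.
- apply/measurable_EFinP; apply: measurable_funM => //.
  exact: (measurableT_comp (@measurable_ln R) mp).
- exact: (measurable_fubini_G iG).
have := ae_integrable2 iG; move: p_gt0; apply: filterS2 => w pw iw.
rewrite /fubini_G.
have -> : (ln (p w) * q w)%:E = (\int[m]_v (ln (p w) * j (v, w))%:E)%E.
  under eq_integral do rewrite EFinM.
  rewrite integralZl ?j2 ?EFinM //.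
  apply/integrableP; split.
    apply/measurable_EFinP; exact: (measurableT_comp mj (measurable_pair2 w)).
  by under eq_integral do rewrite /= ger0_norm //; rewrite j2 ltry.
apply: le_integral_of_ae_le.
- apply/measurable_EFinP; apply: measurable_funM => //.
  exact: (measurableT_comp mj (measurable_pair2 w)).
- exact: measurable_int iw.
- apply: aeW => v; rewrite lee_fin /G /= -!jE /=.
  by rewrite mulrC; exact: gibbs_pointwise.
Qed.
End gibbs.

Section entries.
Context d (T : measurableType d) (R : realType) (k : nat).
Local Notation C := R[i].
Implicit Types (A B : T -> 'M[C]_k).

Lemma entries_measurableM A B : entries_measurable A -> entries_measurable B ->
  entries_measurable (fun v => A v *m B v).
Proof.
move=> mA mB i j; split.
- under [fun v => _]funext do rewrite mxE cRe_sum.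
  apply: measurable_sum => l; under [fun v => _]funext do rewrite cReM.
  by apply: measurable_funB; apply: measurable_funM; apply mA || apply mB.
- under [fun v => _]funext do rewrite mxE cIm_sum.
  apply: measurable_sum => l; under [fun v => _]funext do rewrite cImM.
  by apply: measurable_funD; apply: measurable_funM; apply mA || apply mB.
Qed.

Lemma entries_measurable_cst (M : 'M[C]_k) : entries_measurable (fun _ : T => M).
Proof. by move=> i j; split; exact: measurable_cst. Qed.

Lemma measurable_trRe A : entries_measurable A -> measurable_fun setT (fun v => trRe (A v)).
Proof.
move=> mA; under [fun v => _]funext do rewrite /trRe /mxtrace cRe_sum.
by apply: measurable_sum => i; apply mA.
Qed.
End entries.

Lemma entries_measurable_comp d1 d2 (T1 : measurableType d1) (T2 : measurableType d2)
    (R : realType) k (A : T2 -> 'M[R[i]]_k) (f : T1 -> T2) :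
  measurable_fun setT f -> entries_measurable A -> entries_measurable (A \o f).
Proof.
by move=> mf mA i j; split;
  [exact: (measurableT_comp (mA i j).1 mf)|exact: (measurableT_comp (mA i j).2 mf)].
Qed.

(** * Densities of [L], their marginals, and the reference density of [H] *)

Section densities.
Context {R : realType} {k : nat} (mu : {measure set (borelM R k) -> \bar R}).
Local Notation C := R[i].
Local Notation T := (borelM R k).
Implicit Types (A B M : 'M[C]_k) (L H : T -> 'M[C]_k).
Hypothesis k_gt0 : (0 < k)%N.

Definition joint L (z : T * T) : R :=
  trRe (L z.2 *m L z.1 *m rhoM mu L *m (L z.1) ^t* *m (L z.2) ^t*).

Lemma EFin_Rintegral (f : T -> R) : mu.-integrable setT (EFin \o f) ->
  (\int[mu]_v (f v)%:E = (\int[mu]_v f v)%:E)%E.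
Proof. by move=> fi; rewrite /Rintegral fineK // integrable_fin_num. Qed.

Lemma measurable_density L : entries_measurable L -> measurable_fun setT (density mu L).
Proof.
move=> mL; apply: measurable_trRe; apply: entries_measurableM;
  last exact: entries_measurable_adj.
by apply: entries_measurableM => //; exact: entries_measurable_cst.
Qed.

Lemma measurable_joint L : entries_measurable L -> measurable_fun setT (joint L).
Proof.
move=> mL; have m1 := entries_measurable_comp (@measurable_fst _ _ T T) mL.
have m2 := entries_measurable_comp (@measurable_snd _ _ T T) mL.
apply: measurable_trRe; apply: entries_measurableM; last exact: (entries_measurable_adj m2).
apply: entries_measurableM; last exact: (entries_measurable_adj m1).
apply: entries_measurableM; last exact: entries_measurable_cst.
exact: entries_measurableM.
Qed.

Section irreducible_stochastic.
Variable L : T -> 'M[C]_k.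
Hypothesis gL : admissible mu L.
Hypothesis iL : irreducible mu L.

Let rho_spec := rhoM_spec k_gt0 gL iL.

Lemma psd_rhoM : psd (rhoM mu L).
Proof. by apply: posdef_psd; have [] := rho_spec. Qed.

Lemma density_ge0 v : 0 <= density mu L v.
Proof. by apply: trRe_psd_ge0; apply: psd_conj; exact: psd_rhoM. Qed.

Lemma jointE v w : joint L (v, w) =
  trRe ((L w) *m (L v *m rhoM mu L *m (L v) ^t*) *m (L w) ^t*).
Proof. by rewrite /joint /= !mulmxA. Qed.

Lemma joint_ge0 z : 0 <= joint L z.
Proof.
case: z => v w; rewrite jointE; apply: trRe_psd_ge0; apply: psd_conj; apply: psd_conj.
exact: psd_rhoM.
Qed.

Lemma transition_ge0 v w : 0 <= transition mu L v w.
Proof. by apply: divr_ge0; [exact: (joint_ge0 (v, w))|exact: density_ge0]. Qed.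

(** Where the density vanishes, L(v) rho_L adj(L(v)) is positive with trace 0, hence 0, and the
    joint density vanishes too. *)
Lemma density_transition v w : density mu L v * transition mu L v w = joint L (v, w).
Proof.
rewrite /transition -/(joint L (v, w)); have [d0|d0] := eqVneq (density mu L v) 0.
  rewrite d0 mul0r jointE.
  have := psd_conj (L v) psd_rhoM; rewrite -/(density mu L v).
  move=> /psd_trRe_eq0 -> //; by rewrite mulmx0 mul0mx /trRe mxtrace0.
by rewrite mulrCA mulfV // mulr1.
Qed.

Hypothesis sL : stochastic mu L.

Lemma phi_adj1 : phi mu (fun v => (L v) ^t*) 1%:M = 1%:M.
Proof. by rewrite -phi_starE. Qed.

Lemma trRe_rhoM : trRe (rhoM mu L) = 1.
Proof. by rewrite /trRe; have [_ _ ->] := rho_spec. Qed.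

(** Pairing the eigenvector equation with the identity matrix gives lambda_L = 1. *)
Lemma stochastic_phi_rhoM : phi mu L (rhoM mu L) = rhoM mu L.
Proof.
have [_ h _] := rho_spec.
have := trRe_phi_dual 1%:M (rhoM mu L) gL; rewrite phi_adj1 !mul1mx h trReZ trRe_rhoM.
by rewrite mulr1 => ->; rewrite scale1r.
Qed.

Lemma integral_density : (\int[mu]_v (density mu L v)%:E = 1)%E.
Proof.
have h := trRe_phi 1%:M (rhoM mu L) gL.
have i := integrable_trRe 1%:M (rhoM mu L) gL.
under eq_integral do rewrite /density -[X in trRe X]mul1mx.
by rewrite EFin_Rintegral // -h stochastic_phi_rhoM mul1mx trRe_rhoM.
Qed.

Lemma integral_joint_right v : (\int[mu]_w (joint L (v, w))%:E = (density mu L v)%:E)%E.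
Proof.
set M := L v *m rhoM mu L *m (L v) ^t*.
have h := trRe_phi M 1%:M (admissible_adj gL).
have i := integrable_trRe M 1%:M (admissible_adj gL).
have E w : joint L (v, w) = trRe (M *m ((L w) ^t* *m 1%:M *m (L w) ^t* ^t*)).
  by rewrite jointE trmxCK mulmx1 -/M [LHS]trRe_mulC [RHS]trRe_mulC mulmxA.
under eq_integral do rewrite E.
by rewrite EFin_Rintegral // -h phi_adj1 mulmx1.
Qed.

(** Stationarity: this marginal rests on the invariance of rho_L, while the other one rests on the
    invariance of the identity under the dual operator. *)
Lemma integral_joint_left w : (\int[mu]_v (joint L (v, w))%:E = (density mu L w)%:E)%E.
Proof.
set M := (L w) ^t* *m L w.
have h := trRe_phi M (rhoM mu L) gL.
have i := integrable_trRe M (rhoM mu L) gL.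
have E X : trRe (L w *m X *m (L w) ^t*) = trRe (M *m X).
  by rewrite trRe_mulC mulmxA.
under eq_integral do rewrite jointE E.
by rewrite EFin_Rintegral // -h stochastic_phi_rhoM /density E.
Qed.

End irreducible_stochastic.

Section reference.
Variable H : T -> 'M[C]_k.
Hypothesis gH : admissible mu H.
Hypothesis iH : irreducible mu H.

(** The function p of the overview: the argument of the logarithm in [potential]. *)
Definition reference v : R := trRe (sigmaM mu H *m H v *m rhoM mu H *m (H v) ^t*).

Lemma referenceE v :
  reference v = trRe (sigmaM mu H *m (H v *m rhoM mu H *m (H v) ^t*)).
Proof. by rewrite /reference !mulmxA. Qed.

Let rho_spec := rhoM_spec k_gt0 gH iH.
Let sigma_spec := sigmaM_spec k_gt0 gH iH.

Lemma reference_ge0 v : 0 <= reference v.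
Proof.
rewrite referenceE; apply: trRe_mul_ge0.
  by apply: posdef_psd; have [] := sigma_spec.
by apply: psd_conj; exact: (psd_rhoM gH iH).
Qed.

Lemma reference_gt0 v : H v != 0 -> 0 < reference v.
Proof.
move=> Hv; rewrite referenceE; apply: trRe_mul_gt0.
- by have [] := sigma_spec.
- by apply: psd_conj; exact: (psd_rhoM gH iH).
- apply: contra Hv => /eqP h; have [/posdef_factor[B rB uB] _ _] := rho_spec.
  have : (H v *m B) *m (H v *m B) ^t* = 0 by rewrite adjM !mulmxA -(mulmxA (H v) B) -rB.
  move=> /(congr1 (@trRe R k)); rewrite [in RHS]/trRe mxtrace0 => /trRe_BB_eq0 h2.
  by rewrite -[H v](mulmxK uB) h2 mul0mx.
Qed.

Lemma measurable_reference : measurable_fun setT reference.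
Proof.
have mH := gH.1.
apply: measurable_trRe; apply: entries_measurableM; last exact: entries_measurable_adj.
apply: entries_measurableM; last exact: entries_measurable_cst.
by apply: entries_measurableM => //; exact: entries_measurable_cst.
Qed.

Lemma integral_reference : (\int[mu]_v (reference v)%:E = (lambda mu H)%:E)%E.
Proof.
have h := trRe_phi (sigmaM mu H) (rhoM mu H) gH.
have i := integrable_trRe (sigmaM mu H) (rhoM mu H) gH.
under eq_integral do rewrite referenceE.
rewrite EFin_Rintegral // -h; have [_ -> _] := rho_spec; have [_ _ ht] := sigma_spec.
by rewrite -scalemxAr trReZ /trRe ht mulr1.
Qed.

Lemma lambda_ge0 : 0 <= lambda mu H.
Proof.
rewrite -lee_fin -integral_reference; apply: integral_ge0 => v _.
by rewrite lee_fin reference_ge0.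
Qed.

End reference.
End densities.

Lemma variational_upper_bound (R : realType) (k : nat)
    (mu : {sigma_finite_measure set (borelM R k) -> \bar R}) H L :
  (0 < k)%N -> admissible mu H -> irreducible mu H -> {ae mu, forall v, H v != 0} ->
  0 < lambda mu H -> admissible mu L -> irreducible mu L -> stochastic mu L ->
  entropy_defined mu L ->
  (entropy mu L + \int[mu]_v (potential mu H v * density mu L v)%:E <=
     (ln (lambda mu H))%:E)%E.
Proof.
move=> k0 gH iH H0 l0 gL iL sL eL.
apply: (@gibbs_variational _ _ _ mu (density mu L) (reference mu H) (joint mu L)
  (fun z => transition mu L z.1 z.2)) => //.
- by apply: measurable_density; exact: gL.1.
- exact: (measurable_reference gH).
- by apply: measurable_joint; exact: gL.1.
- exact: (density_ge0 k0 gL iL).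
- exact: (reference_ge0 k0 gH iH).
- by move=> z; exact: (transition_ge0 k0 gL iL).
- by case=> v w; exact: (density_transition k0 gL iL).
- exact: (integral_density k0 gL iL sL).
- exact: (integral_reference k0 gH iH).
- exact: (integral_joint_right gL sL).
- exact: (integral_joint_left k0 gL iL sL).
- by apply: filterS H0 => v; exact: (reference_gt0 k0 gH iH).
Qed.

(** * Operators with prescribed density and independent transitions *)

Section unitaries.
Context {R : realType} {k' : nat}.
Local Notation k := k'.+1.
Local Notation C := R[i].
Implicit Types (P X : 'M[C]_k).

Lemma ordS_inj : injective (@ordS k).
Proof. exact: can_inj (@ordSK k). Qed.

Definition cyc : {perm 'I_k} := perm ordS_inj.

Definition reflection : 'M[C]_k := 1%:M - 2 *: delta_mx 0 0.
Definition shift : 'M[C]_k := perm_mx cyc.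

Lemma cyc_orbit (j : 'I_k) : j \in porbit cyc 0.
Proof.
have h m : (m < k)%N -> (cyc ^+ m)%g 0 = m :> nat.
  elim: m => [|m ih] mk; first by rewrite expg0 perm1.
  by rewrite expgSr permM permE /= ih ?modn_small // ltnW.
by apply/porbitP; exists (nat_of_ord j); apply: ord_inj; rewrite (h _ (ltn_ord j)).
Qed.

Lemma zero_rows X (s : {perm 'I_k}) : (forall j, j \in porbit s 0) -> row 0 X = 0 ->
  (forall i, row i X = 0 -> row (s i) X = 0) -> X = 0.
Proof.
move=> hs X0 XS; apply/row_matrixP => j; rewrite row0.
have /porbitP[n ->] := hs j.
by elim: n => [|n ih]; rewrite ?expg0 ?perm1 // expgSr permM XS.
Qed.

Lemma adj_delta (i j : 'I_k) : (delta_mx i j : 'M[C]_k) ^t* = delta_mx j i.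
Proof. by rewrite trmx_delta map_delta_mx. Qed.

Lemma reflection_unitary : reflection ^t* *m reflection = 1%:M.
Proof.
rewrite /reflection adjD adjN adjZ adj_delta adj1 rmorph_nat.
rewrite mulmxBl mul1mx mulmxBr mulmx1 -scalemxAl -scalemxAr mul_delta_mx.
by rewrite scalerA -{1}[2 *: _]scale1r; apply/matrixP => i j; rewrite !mxE; ring.
Qed.

Lemma shift_adj : shift ^t* = perm_mx cyc^-1.
Proof. by rewrite /shift tr_perm_mx map_perm_mx. Qed.

Lemma shift_unitary : shift ^t* *m shift = 1%:M.
Proof. by rewrite shift_adj -perm_mxM mulVg perm_mx1. Qed.

(** The reflection forces the first basis vector into the range or the kernel of [P]; the shift, a
    single cycle, carries this to all basis vectors. *)
Lemma reflection_shift_irreducible P : hermitian_projector P ->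
  (1%:M - P) *m reflection *m P = 0 -> (1%:M - P) *m shift *m P = 0 ->
  P = 0 \/ P = 1%:M.
Proof.
move=> hP; have [hP1 PP] := hP; set Q := 1%:M - P.
have [hQ1 QQ] : hermitian_projector Q := hermitian_projectorC hP.
have QP : Q *m P = 0 by rewrite mulmxBl mul1mx PP subrr.
have rowM i (X Y : 'M[C]_k) : row i (X *m Y) = row i X *m Y by rewrite row_mul.
have rowsh (s : {perm 'I_k}) i (X : 'M[C]_k) : row i (perm_mx s *m X) = row (s i) X.
  by rewrite -row_permE; apply/rowP => j; rewrite !mxE.
move=> hr hsh.
have hd : Q *m delta_mx 0 0 *m P = 0.
  move: hr; rewrite /reflection mulmxBr mulmx1 mulmxBl QP sub0r -scalemxAr -scalemxAl.
  by move/eqP; rewrite oppr_eq0 scaler_eq0 pnatr_eq0 /= => /eqP.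
have [r0|r0] := eqVneq (row 0 P) 0.
  left; apply: (zero_rows (s := cyc) cyc_orbit r0) => i ri.
  rewrite -rowsh -/shift.
  have -> : shift *m P = P *m (shift *m P).
    by apply/eqP; rewrite -subr_eq0 -[X in X - _]mul1mx -mulmxBl mulmxA; apply/eqP.
  by rewrite rowM ri mul0mx.
have c0 : col 0 Q = 0.
  apply/colP => i; rewrite [RHS]mxE; apply/eqP; rewrite mxE.
  have [j Pj] : exists j, P 0 j != 0.
    apply/existsP; apply: contraNT r0 => /existsPn h; apply/eqP/rowP => j.
    by rewrite !mxE; apply/eqP; have := h j; rewrite negbK.
  have := congr1 (fun X : 'M[C]_k => X i j) hd.
  have -> : Q *m delta_mx 0 0 *m P = col 0 Q *m row 0 P.
    rewrite colE rowE -!mulmxA; congr (_ *m _); rewrite mulmxA; congr (_ *m _).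
    by rewrite mul_delta_mx.
  rewrite mxE big_ord_recl big_ord0 addr0 !mxE => /eqP; rewrite mulf_eq0 => /orP[] //.
  by rewrite (negbTE Pj).
(* Now [Q] kills the first basis vector. By adjunction the range of [Q] is stable under the inverse
   shift, so the cycle is run backwards. *)
right; apply/esym/eqP; rewrite -subr_eq0 -/Q; apply/eqP.
apply: (zero_rows (s := cyc^-1)%g) => [j||i ri].
- by rewrite porbitV; exact: cyc_orbit.
- apply/rowP => j; have := congr1 (fun X : 'cV[C]_k => X j 0) c0; rewrite !mxE => h.
  have := congr1 (fun X : 'M[C]_k => X 0 j) hQ1; rewrite !mxE => <-.
  by rewrite h rmorph0.
- rewrite -rowsh -shift_adj.
  have -> : shift ^t* *m Q = Q *m (shift ^t* *m Q).
    apply/eqP; rewrite -subr_eq0 -[X in X - _]mul1mx -mulmxBl subKr mulmxA.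
    have := congr1 (fun X : 'M[C]_k => X ^t*) hsh.
    by rewrite /= !adjM hQ1 hP1 adj0 mulmxA => ->.
  by rewrite rowM ri mul0mx.
Qed.

End unitaries.

Lemma scalec_continuous (R : realType) (c : R[i]) :
  continuous ((fun s => s%:C%C * c) : R -> R[i]^o).
Proof.
move=> s.
have FF : Filter (nbhs (s : R)) by exact: nbhs_filter.
have h := @cvgrPdist_lt R[i] R[i]^o R (nbhs s) FF (fun s => s%:C%C * c) (s%:C%C * c).
apply: h.2 => e e0.
pose d := complex.Re `|c|.
have cE : `|c| = d%:C%C by rewrite RRe_real // normr_real.
have d0 : 0 <= d by rewrite -ler0c -cE.
have eE : e = (complex.Re e)%:C%C by rewrite RRe_real // gtr0_real.
have e1 : 0 < complex.Re e by rewrite -ltcR -eE.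
have e2 : 0 < complex.Re e / (d + 1) by rewrite divr_gt0 // ltr_wpDl.
have := @cvgr_dist_lt _ R _ _ FF id s (@cvg_id _ (nbhs s)) _ e2.
apply: filterS => t /= st.
rewrite -mulrBl normrM -rmorphB /= cE eE normc_def /= expr0n /= addr0 sqrtr_sqr -rmorphM ltcR.
apply: (@le_lt_trans _ _ (`|s - t| * (d + 1))); first by rewrite ler_wpM2l // lerDl ler01.
by rewrite -ltr_pdivlMr // ltr_wpDl.
Qed.

(** [phi_mu] asks for Borel measurability of a matrix-valued map. Preimages of open sets are open
    here because a matrix neighbourhood contains a product of neighbourhoods of the entries. *)
Lemma measurable_scale_cst (R : realType) k (u : 'M[R[i]]_k) :
  measurable_fun setT ((fun s : R => s%:C%C *: u) : R -> borelM R k).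
Proof.
have h : @measurable _ (borelM R k) = <<s (@open 'M[R[i]^o]_k) >> by [].
apply: (measurability _ h).
move=> _ [U oU <-]; rewrite setTI; apply: open_measurable.
rewrite openE => s /= Us; rewrite /interior.
have [P hP sPU] : nbhs (s%:C%C *: u : 'M[R[i]^o]_k) U by exact: open_nbhs_nbhs.
suff : \forall t \near s, forall ij : 'I_k * 'I_k, P ij.1 ij.2 (t%:C%C * u ij.1 ij.2).
  by apply: filterS => t ht; apply: sPU => i j; have := ht (i, j); rewrite !mxE.
apply: (@filter_forall R ('I_k * 'I_k)%type
  (fun ij => [set t : R | P ij.1 ij.2 (t%:C%C * u ij.1 ij.2)]) (nbhs s)) => -[i j].
have hPij : nbhs (s%:C%C * u i j : R[i]^o) (P i j) by have := hP i j; rewrite mxE.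
exact: (scalec_continuous hPij).
Qed.

Section bernoulli.
Context {R : realType} {k' : nat}.
Local Notation k := k'.+1.
Context (mu : {measure set (borelM R k) -> \bar R}).
Local Notation C := R[i].
Local Notation T := (borelM R k).
Variables (a : T -> R) (A : set T).
Hypothesis ma : measurable_fun setT a.
Hypothesis a0 : forall v, 0 <= a v.
Hypothesis mA : measurable A.
Hypothesis a1 : (\int[mu]_v (a v)%:E = 1)%E.

Definition unitary_choice (v : T) : 'M[C]_k := if v \in A then reflection else shift.

(** The product of adj(L(v)) and L(v) is the scalar a(v), so the weight of an outcome does not
    depend on the state and successive outcomes are independent, as in a Bernoulli shift. *)
Definition bernoulli_op (v : T) : 'M[C]_k := (Num.sqrt (a v))%:C%C *: unitary_choice v.
Local Notation L := bernoulli_op.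

Lemma unitary_choiceE v : (unitary_choice v) ^t* *m unitary_choice v = 1%:M.
Proof.
rewrite /unitary_choice; case: ifP => _; [exact: reflection_unitary|exact: shift_unitary].
Qed.

Lemma bernoulli_opE v : (L v) ^t* *m L v = (a v)%:C%C *: 1%:M.
Proof.
rewrite /bernoulli_op adjZ -scalemxAl -scalemxAr scalerA unitary_choiceE.
by rewrite conj_Creal ?complex_real // -rmorphM /= -expr2 sqr_sqrtr.
Qed.

Lemma measurable_bernoulli_op : measurableM L.
Proof.
have ms : measurable_fun setT (fun v => Num.sqrt (a v)).
  exact: (measurableT_comp (continuous_measurable_fun (@sqrt_continuous R)) ma).
have -> : L = (fun v : T => if v \in A then (Num.sqrt (a v))%:C%C *: reflection
   else (Num.sqrt (a v))%:C%C *: shift) :> (T -> T).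
  by apply/funext => v; rewrite /bernoulli_op /unitary_choice; case: ifP.
apply: measurable_fun_ifT.
- apply: (@measurable_fun_bool _ _ _ _ true); rewrite setTI.
  rewrite (_ : _ @^-1` _ = A) //; apply/seteqP; split=> v /=; [exact: set_mem|exact: mem_set].
- exact: (measurableT_comp (@measurable_scale_cst R k reflection) ms).
- exact: (measurableT_comp (@measurable_scale_cst R k shift) ms).
Qed.

Lemma integrable_weight : mu.-integrable setT (EFin \o a).
Proof.
apply/integrableP; split; first exact/measurable_EFinP.
by under eq_integral do rewrite /= ger0_norm //; rewrite a1 ltry.
Qed.

Lemma bernoulli_HSnorm v : HSnorm (L v) ^+ 2 = k%:R * a v.
Proof. by rewrite -HSnorm_adj HSnorm_sq trmxCK bernoulli_opE trReZ trRe1 mulrC. Qed.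

Lemma bernoulli_admissible : admissible mu L.
Proof.
split; first exact: (measurableM_entries measurable_bernoulli_op).
rewrite /square_integrable; under eq_integral do rewrite bernoulli_HSnorm EFinM.
by rewrite integralZl ?a1 ?mule1 ?ltry //; exact: integrable_weight.
Qed.

Lemma bernoulli_stochastic : stochastic mu L.
Proof.
rewrite /stochastic; apply/matrixP => i j; rewrite [LHS]mxE.
have E v : ((L v) ^t* *m 1%:M *m L v) i j = (1%:M : 'M[C]_k) i j * (a v)%:C%C.
  by rewrite mulmx1 bernoulli_opE mxE mulrC.
under [fun v => _]funext do rewrite E.
rewrite cintegralZ; last by split; [exact: integrable_weight|exact: integrable0].
rewrite (_ : cintegral mu _ = 1) ?mulr1 //.
apply: complexP => /=; first by rewrite /Rintegral a1.
by rewrite Rintegral_cst // mul0r.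
Qed.

Lemma exists_of_ae (D : set T) (P : T -> Prop) : measurable D -> (0 < mu D)%E ->
  {ae mu, forall v, P v} -> exists2 v, D v & P v.
Proof.
move=> mD D0 aeP; apply: contrapT => h.
have /negligibleP : mu.-negligible D.
  by apply: negligibleS aeP => v Dv Pv; apply: h; exists v.
by move=> /(_ mD) D00; rewrite D00 ltxx in D0.
Qed.

Lemma idempotent1 (P : 'M[C]_1) : P *m P = P -> P = 0 \/ P = 1%:M.
Proof.
move=> h; have := congr1 (fun X : 'M[C]_1 => X 0 0) h.
rewrite mxE big_ord_recl big_ord0 addr0 => /eqP; rewrite -subr_eq0 -{3}[P 0 0]mulr1 -mulrBr.
rewrite mulf_eq0 => /orP[/eqP e|]; [left|rewrite subr_eq0 => /eqP e; right];
  by apply/matrixP => i j; rewrite !ord1 e !mxE ?eqxx.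
Qed.

(** In dimension 1 all projectors are trivial; otherwise both unitaries must occur with positive
    weight. *)
Hypothesis split_weight : k = 1%N \/
  (0 < mu (A `&` [set v | (0 < a v)%R]))%E /\
  (0 < mu (~` A `&` [set v | (0 < a v)%R]))%E.

Lemma bernoulli_irreducible : irreducible mu L.
Proof.
move=> P hP hinv; have [hP1 PP] := hP.
have [k1|[s1 s2]] := split_weight.
  by move: P PP {hP hP1 hinv}; case: k1 => ->; exact: idempotent1.
set Q := 1%:M - P.
have [hQ1 QQ] : hermitian_projector Q := hermitian_projectorC hP.
have QP : Q *m P = 0 by rewrite mulmxBl mul1mx PP subrr.
(* The inclusion at the identity matrix already gives tr (Q phi P) = 0, an integral of squared norms
   of Q L(v) P. *)
have [B hB] := hinv 1%:M.
rewrite mulmx1 PP in hB.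
have : trRe (Q *m phi mu L P) = 0.
  by rewrite hB !mulmxA QP !mul0mx /trRe mxtrace0.
rewrite trRe_phi; last exact: bernoulli_admissible.
move=> /(Rintegral_eq0_ae (integrable_trRe Q P bernoulli_admissible)).
have E v : trRe (Q *m (L v *m P *m (L v) ^t*)) = trRe ((Q *m L v *m P) *m (Q *m L v *m P) ^t*).
  rewrite !adjM hQ1 hP1 !mulmxA -(mulmxA _ P P) PP.
  by rewrite /trRe [in RHS]mxtrace_mulC !mulmxA QQ.
move=> h; have {h}hae : {ae mu, forall v, trRe (Q *m (L v *m P *m (L v) ^t*)) = 0}.
  by apply: h => v; rewrite E; apply: trRe_psd_ge0; exact: psd_mulBB.
have mpos : measurable [set v | 0 < a v].
  have -> : [set v | 0 < a v] = a @^-1` `]0, +oo[%classic.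
    by apply/seteqP; split => v /=; rewrite in_itv /= andbT.
  by rewrite -[X in measurable X]setTI; exact: ma.
have U0 v : 0 < a v -> trRe (Q *m (L v *m P *m (L v) ^t*)) = 0 ->
    Q *m unitary_choice v *m P = 0.
  move=> av; rewrite E => /trRe_BB_eq0 /eqP.
  rewrite /bernoulli_op -scalemxAr -scalemxAl scaler_eq0 => /orP[|/eqP //].
  by rewrite (inj_eq (@complexI R) _ 0) sqrtr_eq0 leNgt av.
(* One point on each side is enough, because the unitary is constant on [A] and on its
   complement. *)
have [v1 [A1 p1] h1] := exists_of_ae (measurableI _ _ mA mpos) s1 hae.
have [v2 [A2 p2] h2] := exists_of_ae (measurableI _ _ (measurableC mA) mpos) s2 hae.
apply: reflection_shift_irreducible => //.
- by have := U0 _ p1 h1; rewrite /unitary_choice mem_set.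
- by have := U0 _ p2 h2; rewrite /unitary_choice memNset.
Qed.

Lemma bernoulli_phi_mu : phi_mu mu L.
Proof.
split; [exact: measurable_bernoulli_op|exact: bernoulli_admissible.2|
  exact: bernoulli_irreducible|exact: bernoulli_stochastic].
Qed.

Let rho_spec := rhoM_spec (ltn0Sn k') bernoulli_admissible bernoulli_irreducible.

Lemma bernoulli_trRe M v : trRe (L v *m M *m (L v) ^t*) = a v * trRe M.
Proof. by rewrite trRe_mulC mulmxA bernoulli_opE -scalemxAl mul1mx trReZ. Qed.

Lemma bernoulli_density v : density mu L v = a v.
Proof.
rewrite /density bernoulli_trRe /trRe; have [_ _ ->] := rho_spec.
by rewrite mulr1.
Qed.

Lemma bernoulli_transition v w : a v != 0 -> transition mu L v w = a w.
Proof.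
move=> av; rewrite /transition bernoulli_density.
have -> : L w *m L v *m rhoM mu L *m (L v) ^t* *m (L w) ^t* =
  L w *m (L v *m rhoM mu L *m (L v) ^t*) *m (L w) ^t* by rewrite !mulmxA.
by rewrite bernoulli_trRe -/(density mu L v) bernoulli_density mulfK.
Qed.

Lemma bernoulli_entropy_integrand z :
  entropy_integrand mu L z = (a z.1 * (a z.2 * ln (a z.2)))%:E.
Proof.
rewrite /entropy_integrand bernoulli_density.
by have [->|h] := eqVneq (a z.1) 0; rewrite ?mul0r // bernoulli_transition.
Qed.

End bernoulli.

(** * Measures taking two values *)

Section zero_one.
Context d (T : measurableType d) (R : realType) (mu : {measure set T -> \bar R}).
Hypothesis zero_one : forall A, measurable A -> mu A = 0%E \/ mu (~` A) = 0%E.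

(** The constant is the supremum of all t with t <= f almost everywhere; any t above it satisfies f
    < t almost everywhere. The null measure is set apart because every t then qualifies. *)
Lemma zero_one_ae_const (f : T -> R) : measurable_fun setT f ->
  exists c, {ae mu, forall v, f v = c}.
Proof.
move=> mf.
have [null|nonnull] := pselect ({ae mu, forall v : T, False}).
  by exists 0; apply: filterS null.
have dich t : {ae mu, forall v, t <= f v} \/ {ae mu, forall v, f v < t}.
  pose A := f @^-1` `]-oo, t[%classic.
  have mA : measurable A by rewrite -[A]setTI; exact: mf.
  have [h|h] := zero_one mA; [left|right].
    exists A; split => // v /= /negP; rewrite -ltNge => h1.
    by rewrite /A /= in_itv.
  exists (~` A); split => //; first exact: measurableC.
pose S := [set t | {ae mu, forall v, t <= f v}].
have S0 : S !=set0.
  apply: contrapT => h; apply: nonnull.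
  have : {ae mu, forall v, forall n, f v < - n%:R}.
    apply/ae_foralln => n; have [h1|//] := dich (- n%:R).
    by exfalso; apply: h; exists (- n%:R).
  apply: filterS => v /(_ (Num.truncn (- f v)).+1).
  by rewrite ltrNr => /(lt_trans (truncnS_gt _)); rewrite ltxx.
have [u Su] : exists u, ~ S u.
  apply: contrapT => h; apply: nonnull.
  have : {ae mu, forall v, forall n, n%:R <= f v}.
    by apply/ae_foralln => n; apply: contrapT => h1; apply: h; exists n%:R.
  apply: filterS => v /(_ (Num.truncn (f v)).+1) /(lt_le_trans (truncnS_gt _)).
  by rewrite ltxx.
have Sdown t t' : t' <= t -> S t -> S t'.
  by move=> tt'; apply: filterS => v; exact: le_trans.
have Sub t : S t -> t <= u.
  by move=> St; rewrite leNgt; apply/negP => ut; apply: Su; exact: Sdown (ltW ut) St.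
have hsS : has_sup S by split => //; exists u => t /Sub.
exists (sup S).
have hlow : {ae mu, forall v, forall n : nat, sup S - n.+1%:R^-1 <= f v}.
  apply/ae_foralln => n.
  have [t St ht] : exists2 t, S t & sup S - n.+1%:R^-1 < t by apply: sup_adherent => //.
  exact: Sdown (ltW ht) St.
have hup : {ae mu, forall v, forall n : nat, f v < sup S + n.+1%:R^-1}.
  apply/ae_foralln => n; have [h|//] := dich (sup S + n.+1%:R^-1).
  have : sup S + n.+1%:R^-1 <= sup S by apply: sup_upper_bound.
  by rewrite gerDl leNgt invr_gt0 ltr0n.
move: hup; apply: filterS2 hlow => v hl hu; apply/eqP; rewrite eq_le; apply/andP; split.
- rewrite leNgt; apply/negP => /ltr_add_invr[n]; move=> /(lt_trans (hu n)); by rewrite ltxx.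
- rewrite leNgt; apply/negP => /ltr_add_invr[n]; rewrite -ltrBrDr => /(le_lt_trans (hl n)).
  by rewrite ltxx.
Qed.
End zero_one.

Section split.
Context {R : realType} {k : nat} (mu : {measure set (borelM R k) -> \bar R}).
Local Notation C := R[i].
Local Notation T := (borelM R k).

Lemma irreducible_not_ae_const (H : T -> 'M[C]_k) (H0 : 'M[C]_k) : (1 < k)%N ->
  admissible mu H -> irreducible mu H -> ~ {ae mu, forall v, H v = H0}.
Proof.
move=> k1 gH iH hc; have k0 : (0 < k)%N by exact: ltnW.
(* [eigenvalue] concerns row vectors: a column eigenvector of [H0] is the adjoint of a row
   eigenvector of the adjoint of [H0]. *)
have [a /eigenvalueP[u ua u0]] := eigenvalue_closed (H0 ^t*) k0.
pose x := u ^t*.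
have Hx : H0 *m x = a^* *: x.
  by rewrite /x -adjZ -ua adjM trmxCK.
have x0 : x != 0 by apply: contra u0 => /eqP h; rewrite -[u]trmxCK -/x h adj0.
have n0 : nrm x != 0 by rewrite nrm_eq0.
pose P := (nrm x)^-1%:C%C *: (x *m x ^t*).
have xx : x ^t* *m x = (nrm x)%:C%C%:M.
  by rewrite [LHS]mx11_scalar -qf1 /qf mulmx1.
have Px : P *m x = x.
  rewrite /P -scalemxAl -mulmxA xx mul_mx_scalar scalerA -rmorphM /= mulVf //.
  by rewrite scale1r.
have hP : hermitian_projector P.
  split; first by rewrite /P adjZ adjM trmxCK conj_Creal // complex_real.
  by rewrite {2}/P -scalemxAr mulmxA Px.
have [|P0|P1] := irreducible_proj gH iH hP.
- apply: filterS hc => v ->.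
  rewrite -mulmxA {2}/P -scalemxAr [H0 *m _]mulmxA Hx -scalemxAl scalerA -scalemxAr mulmxA.
  by rewrite mulmxBl mul1mx Px subrr mul0mx scaler0.
- by move/eqP: x0; rewrite -Px P0 mul0mx.
- have : (\rank P <= 1)%N.
    rewrite /P (leq_trans (mxrankS (scalemx_sub _ (submx_refl _)))) //.
    by rewrite (leq_trans (mxrankM_maxl _ _)) // rank_leq_col.
  by rewrite P1 mxrank1 leqNgt k1.
Qed.

Lemma exists_split_set (H : T -> 'M[C]_k) : (1 < k)%N -> admissible mu H -> irreducible mu H ->
  exists A, [/\ measurable A, (0 < mu A)%E & (0 < mu (~` A))%E].
Proof.
move=> k1 gH iH; apply: contrapT => h.
have zo A : measurable A -> mu A = 0%E \/ mu (~` A) = 0%E.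
  move=> mA; apply: contrapT => /not_orP[h1 h2]; apply: h; exists A; split=> //.
    by rewrite lt0e measure_ge0 andbT; apply/eqP.
  by rewrite lt0e measure_ge0 andbT; apply/eqP.
have mH := gH.1.
pose cst_of (f : T -> R) := xget 0 [set c | {ae mu, forall v, f v = c}].
have cst_ofP f : measurable_fun setT f -> {ae mu, forall v, f v = cst_of f}.
  move=> mf; have [c hc] := zero_one_ae_const zo mf.
  by have := xgetPex 0 (P := [set c | {ae mu, forall v, f v = c}]) (ex_intro _ c hc).
pose H0 : 'M[C]_k := \matrix_(i, j) Complex (cst_of (fun v => complex.Re (H v i j)))
   (cst_of (fun v => complex.Im (H v i j))).
apply: (irreducible_not_ae_const (H0 := H0) k1 gH iH).
have : {ae mu, forall v, forall ij : 'I_k * 'I_k, H v ij.1 ij.2 = H0 ij.1 ij.2}.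
  apply: filter_forall => -[i j] /=.
  move: (cst_ofP _ (mH i j).1); apply: filterS2 (cst_ofP _ (mH i j).2) => v hI hR.
  by rewrite mxE; apply: complexP.
by apply: filterS => v hv; apply/matrixP => i j; exact: (hv (i, j)).
Qed.
End split.

(** * The variational lower bound *)

Section sigma_finiteness.
Context {R : realType} {k : nat} (mu : {measure set (borelM R k) -> \bar R}).
Local Notation T := (borelM R k).

(** Chebyshev: the sets where the squared norm of H is at least 1/(n+1) have finite measure. They
    miss only the null set where H vanishes, which is added to each of them. *)
Lemma admissible_sigma_finite (H : T -> 'M[R[i]]_k) : admissible mu H ->
  {ae mu, forall v, H v != 0} -> sigma_finite setT mu.
Proof.
move=> gH H0; have mN := measurable_HSnorm gH.1.
pose N v := HSnorm (H v) ^+ 2.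
pose E n := N @^-1` `[n.+1%:R^-1, +oo[%classic.
pose Z := N @^-1` [set 0].
have mE n : measurable (E n) by rewrite -[E n]setTI; exact: mN.
have mZ : measurable Z by rewrite -[Z]setTI; exact: mN.
have Z0 : mu Z = 0%E.
  apply/negligibleP => //; apply: negligibleS H0 => v /= Zv h.
  by move: h; rewrite (HSnorm_eq0 Zv) eqxx.
have Efin n : (mu (E n) < +oo)%E.
  have -> : mu (E n) = (\int[mu]_v (\1_(E n) v)%:E)%E by rewrite integral_indic // setIT.
  apply: (@le_lt_trans _ _ (\int[mu]_v (n.+1%:R%:E * (N v)%:E))%E).
    apply: ge0_le_integral => //.
    - by apply/measurable_EFinP; exact: measurable_indic.
    - by apply: measurable_funeM; exact/measurable_EFinP.
    - move=> v _; rewrite -EFinM lee_fin indicE; case: (boolP (v \in E n)) => [|_].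
        rewrite inE /E /= in_itv /= andbT => h.
        by rewrite -(@ler_pM2l _ (n.+1%:R^-1)) ?invr_gt0 // mulr1 mulKf.
      by rewrite mulr_ge0 // sqr_ge0.
  rewrite ge0_integralZl_EFin //; last first.
  - exact/measurable_EFinP.
  - by move=> v _; rewrite lee_fin sqr_ge0.
  by apply: lte_mul_pinfty; [rewrite lee_fin|by []|exact: gH.2].
exists (fun n => Z `|` E n).
  apply/seteqP; split=> // v _.
  have [Nv|Nv] := eqVneq (N v) 0; first by exists 0%N => //; left.
  have Npos : 0 < N v by rewrite lt_neqAle eq_sym Nv sqr_ge0.
  have [n hn] := ltr_add_invr Npos.
  by exists n => //; right; rewrite /E /= in_itv /= andbT ltW // -[ltLHS]add0r.
move=> n; split; first exact: measurableU.
have fin : (mu Z + mu (E n) < +oo)%E by rewrite Z0 add0e Efin.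
exact: le_lt_trans (measureU2 mu mZ (mE n)) fin.
Qed.

(** Fubini takes a bundled sigma-finite measure; the equation allows substituting one for [mu]. *)
Lemma sigma_finite_measureE : sigma_finite setT mu ->
  exists sm : {sigma_finite_measure set T -> \bar R}, sm = mu :> {measure set T -> \bar R}.
Proof.
case: mu => m [c am] /= sf.
pose m0 : {measure set T -> \bar R} := Measure.Pack (Measure.Class am).
pose sm : {sigma_finite_measure set T -> \bar R} := HB.pack m m0
  (@Measure_isSigmaFinite.Build _ _ _ m0 sf).
by exists sm.
Qed.
End sigma_finiteness.

Section truncation.
Context d (T : measurableType d) (R : realType) (mu : {measure set T -> \bar R}).
Variables (f : T -> R) (l : R).
Hypothesis mf : measurable_fun setT f.
Hypothesis f0 : forall v, 0 <= f v.
Hypothesis fl : (\int[mu]_v (f v)%:E = l%:E)%E.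

(** The index is shifted by one from the overview, so that n = 0 involves no inverse of zero. *)
Definition level (n : nat) : set T := f @^-1` `[n.+1%:R^-1, n.+1%:R].

Lemma measurable_level n : measurable (level n).
Proof. by rewrite -[level n]setTI; exact: mf. Qed.

Lemma levelP n v : level n v <-> n.+1%:R^-1 <= f v <= n.+1%:R.
Proof. by rewrite /level /= in_itv. Qed.

Lemma level_gt0 n v : level n v -> 0 < f v.
Proof. by move=> /levelP/andP[h _]; apply: lt_le_trans h; rewrite invr_gt0. Qed.

Lemma level_mono m n : (m <= n)%N -> level m `<=` level n.
Proof.
move=> mn v /levelP/andP[h1 h2]; apply/levelP; apply/andP; split.
  by apply: le_trans h1; rewrite lef_pV2 ?posrE // ler_nat ltnS.
by apply: (le_trans h2); rewrite ler_nat ltnS.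
Qed.

Lemma in_level v : 0 < f v -> exists n, level n v.
Proof.
move=> fv; have [m hm] := ltr_add_invr fv; rewrite add0r in hm.
pose p := Num.truncn (f v); exists (maxn m p); apply/levelP; apply/andP; split.
  by apply: le_trans (ltW hm); rewrite lef_pV2 ?posrE // ler_nat ltnS leq_maxl.
by apply: (le_trans (ltW (truncnS_gt (f v)))); rewrite ler_nat ltnS leq_maxr.
Qed.

Lemma truncated_integral_cvg :
  (\int[mu]_v (f v * \1_(level n) v)%:E @[n --> \oo] --> l%:E)%E.
Proof.
rewrite -fl.
have -> : (\int[mu]_v (f v)%:E)%E = (\int[mu]_v limn (fun n => (f v * \1_(level n) v)%:E))%E.
  apply: eq_integral => v _; apply/esym/cvg_lim => //.
  have [fv|fv] := eqVneq (f v) 0.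
    rewrite fv; under [X in X @ _ --> _]funext do rewrite mul0r.
    exact: cvg_cst.
  have [N hN] : exists n, level n v by apply: in_level; rewrite lt_neqAle eq_sym fv f0.
  apply: cvg_near_cst; exists N => // n /= Nn.
  by rewrite indicE mem_set ?mulr1 //; exact: level_mono hN.
apply: cvg_monotone_convergence => //.
- move=> n; apply/measurable_EFinP; apply: measurable_funM => //.
  by apply: measurable_indic; exact: measurable_level.
- by move=> n v _; rewrite lee_fin mulr_ge0.
- move=> v _ m n mn; rewrite lee_fin ler_wpM2l // !indicE ler_nat.
  case: (boolP (v \in level m)) => //; rewrite inE => h.
  by rewrite mem_set //; exact: level_mono h.
Qed.

Lemma truncated_integral_gt (r : R) : r < l ->
  exists N, forall n, (N <= n)%N -> r < \int[mu]_v (f v * \1_(level n) v).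
Proof.
move=> rl; have h := @fine_cvg _ _ _ eventually_filter _ _ truncated_integral_cvg.
by have [N _ hN] := cvgr_gt _ h _ rl; exists N => n Nn; exact: hN.
Qed.

(** The levels increase and exhaust the set where f > 0; if all traces on [A] were null, [A] would
    be a countable union of null sets. *)
Lemma level_positive (A : set T) : measurable A -> {ae mu, forall v, 0 < f v} ->
  (0 < mu A)%E -> exists N, forall n, (N <= n)%N -> (0 < mu (A `&` level n))%E.
Proof.
move=> mA fp A0; apply: contrapT => h.
have hn N : mu (A `&` level N) = 0%E.
  apply: contrapT => hN; apply: h; exists N => n Nn.
  have hN' : (0 < mu (A `&` level N))%E by rewrite lt0e measure_ge0 andbT; apply/eqP.
  apply: lt_le_trans hN' _; apply: le_measure; rewrite ?inE.
  - exact: measurableI (measurable_level _).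
  - exact: measurableI (measurable_level _).
  - by apply: setIS; exact: level_mono.
have : mu.-negligible A.
  apply: (@negligibleS _ _ _ _ (\bigcup_n (A `&` level n) `|` ~` [set v | 0 < f v])).
    move=> v Av; have [fv|fv] := pselect (0 < f v); last by right.
    by left; have [n hv] := in_level fv; exists n.
  apply: negligibleU => //; apply: negligible_bigcup => n.
  by apply/negligibleP; [exact: measurableI mA (measurable_level n)|exact: hn].
by move=> /(negligibleP _ mA) A00; rewrite A00 ltxx in A0.
Qed.
End truncation.

Section product_functions.
Context d (T : measurableType d) (R : realType).
Variable m : {sigma_finite_measure set T -> \bar R}.
Variables (a b : T -> R).
Hypothesis ia : m.-integrable setT (EFin \o a).
Hypothesis ib : m.-integrable setT (EFin \o b).

Let ma : measurable_fun setT a. Proof. by apply/measurable_EFinP; exact: measurable_int ia. Qed.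
Let mb : measurable_fun setT b. Proof. by apply/measurable_EFinP; exact: measurable_int ib. Qed.

Lemma integrable_product :
  ((m \x m)%E).-integrable setT (fun z => (a z.1 * b z.2)%:E).
Proof.
apply/integrable12ltyP.
  apply/measurable_EFinP; apply: measurable_funM.
    exact: (measurableT_comp ma measurable_fst).
  exact: (measurableT_comp mb measurable_snd).
have [_ fa] := integrableP _ _ _ ia; have [_ fb] := integrableP _ _ _ ib.
under eq_integral => v _.
  under eq_integral do rewrite /= normrM EFinM.
  rewrite ge0_integralZl_EFin //; last by apply/measurable_EFinP; exact: measurableT_comp mb.
  over.
rewrite ge0_integralZr //; last 2 first.
- by apply/measurable_EFinP; exact: measurableT_comp ma.
- exact: integral_ge0.
by apply: lte_mul_pinfty => //; [exact: integral_ge0|rewrite ge0_fin_numE //;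
  exact: integral_ge0].
Qed.

Lemma integral_product :
  (\int[(m \x m)%E]_z (a z.1 * b z.2)%:E = (\int[m]_v a v * \int[m]_v b v)%:E)%E.
Proof.
rewrite -(integral12_prod_meas1 integrable_product) /fubini_F /=.
under eq_integral => v _.
  under eq_integral do rewrite EFinM.
  rewrite integralZl //.
  rewrite -[X in (_ * X)%E]fineK; last exact: (integrable_fin_num _ ib).
  over.
rewrite integralZr // EFinM -[X in (X * _)%E]fineK //.
exact: integrable_fin_num.
Qed.

End product_functions.

Section lower_bound.
Context {R : realType} {k' : nat}.
Local Notation k := k'.+1.
Variable mu : {sigma_finite_measure set (borelM R k) -> \bar R}.
Local Notation C := R[i].
Local Notation T := (borelM R k).
Variable H : T -> 'M[C]_k.
Hypothesis gH : admissible mu H.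
Hypothesis iH : irreducible mu H.
Hypothesis H0 : {ae mu, forall v, H v != 0}.
Let k_gt0 : (0 < k)%N := ltn0Sn k'.
Let f := reference mu H.
Let mf := measurable_reference gH.
Let f0 := reference_ge0 k_gt0 gH iH.
Let fl := integral_reference k_gt0 gH iH.

Let fpos : {ae mu, forall v, 0 < f v}.
Proof. by apply: filterS H0 => v; exact: (reference_gt0 k_gt0 gH iH). Qed.

Lemma pressure_ge_truncation (A : set T) n (Z := \int[mu]_v (f v * \1_(level f n) v)) :
  measurable A -> 0 < Z ->
  k = 1%N \/ (0 < mu (A `&` level f n))%E /\ (0 < mu (~` A `&` level f n))%E ->
  ((ln Z)%:E <= pressure mu H)%E.
Proof.
move=> mA Z0 split_level.
have mD : measurable (level f n) := measurable_level mf n.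
pose g v := f v * \1_(level f n) v.
have mg : measurable_fun setT g by apply: measurable_funM => //; exact: measurable_indic.
have g0 v : 0 <= g v by rewrite mulr_ge0 //; exact: f0.
have fi : mu.-integrable setT (EFin \o f).
  apply/integrableP; split; first exact/measurable_EFinP.
  by under eq_integral do rewrite /= ger0_norm ?f0 //; rewrite fl ltry.
have ig : mu.-integrable setT (EFin \o g).
  apply: le_integrable fi => //; first exact/measurable_EFinP.
  move=> v _; rewrite lee_fin !ger0_norm ?f0 // /g indicE.
  by case: (v \in _); rewrite ?mulr1 // mulr0 f0.
pose a v := Z^-1 * g v.
have ma : measurable_fun setT a by apply: measurable_funM => //; exact: measurable_cst.
have a0 v : 0 <= a v by rewrite mulr_ge0 // invr_ge0 ltW.
have ia : mu.-integrable setT (EFin \o a) by exact: integrableZR.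
have Ra : \int[mu]_v a v = 1 by rewrite /a RintegralZl // mulVf // gt_eqF.
have a1 : (\int[mu]_v (a v)%:E = 1)%E by rewrite EFin_Rintegral // Ra.
have apos : [set v | 0 < a v] = level f n.
  apply/seteqP; split=> v /=; rewrite /a /g indicE.
    by case: (boolP (v \in level f n)) => [|_]; rewrite ?inE // !mulr0 ltxx.
  by move=> hv; rewrite mem_set // mulr1 mulr_gt0 ?invr_gt0 //; exact: level_gt0 hv.
have split_weight : k = 1%N \/
  (0 < mu (A `&` [set v | (0 < a v)%R]))%E /\ (0 < mu (~` A `&` [set v | (0 < a v)%R]))%E.
  by rewrite apos.
have aE v : a v * ln (a v) = a v * ln (f v) - ln Z * a v.
  have [hv|hv] := pselect (level f n v); last first.
    by rewrite /a /g indicE memNset // !mulr0 !mul0r subr0.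
  have fv : 0 < f v := level_gt0 hv.
  rewrite {2}/a /g indicE mem_set // mulr1 lnM ?posrE ?invr_gt0 // lnV ?posrE //; ring.
(* What truncation buys: on the level, ln f is bounded by ln (n+1) in absolute value. *)
have iaf : mu.-integrable setT (EFin \o (fun v => a v * ln (f v))).
  apply: le_integrable (integrableZR (ln n.+1%:R) ia) => //.
    apply/measurable_EFinP; apply: measurable_funM => //.
    exact: (measurableT_comp (@measurable_ln R) mf).
  move=> v _; rewrite /= lee_fin (normrM (a v)) (normrM (ln _)) (ger0_norm (a0 v)) [leRHS]mulrC.
  have [hv|hv] := pselect (level f n v); last first.
    by rewrite /a /g indicE memNset // !mulr0 !mul0r lexx.
  rewrite ler_wpM2l // (le_trans _ (ler_norm _)) // ler_norml.
  have fv : 0 < f v := level_gt0 hv.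
  move/levelP : hv => /andP[h1 h2].
  by rewrite -lnV ?posrE // !ler_ln ?posrE ?invr_gt0 // h1 h2.
have ial : mu.-integrable setT (EFin \o (fun v => a v * ln (a v))).
  under [X in _.-integrable _ (EFin \o X)]funext do rewrite aE.
  by apply: integrableBR => //; exact: integrableZR.
pose L := bernoulli_op a A.
have eE : entropy_integrand mu L = fun z => (a z.1 * (a z.2 * ln (a z.2)))%:E.
  by apply/funext => z; exact: bernoulli_entropy_integrand.
apply: ereal_sup_ubound; exists L.
  split; first exact: bernoulli_phi_mu.
  by rewrite /entropy_defined eE; exact: (integrable_product ia ial).
(* By independence the entropy is minus the integral of a ln a. Adding the integral of a ln f leaves
   ln Z, since ln a = ln f - ln Z on the level. *)
rewrite /entropy eE (integral_product ia ial) Ra mul1r.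
have pE v : potential mu H v * density mu L v = a v * ln (f v).
  by rewrite /L bernoulli_density; [exact: mulrC|..].
under [X in (_ + X)%E]eq_integral do rewrite pE.
rewrite EFin_Rintegral //.
under eq_Rintegral do rewrite aE.
rewrite RintegralB //; last exact: integrableZR.
rewrite RintegralZl // Ra mulr1 -EFinN -EFinD; congr EFin.
by rewrite opprB subrK.
Qed.

Lemma variational_lower_bound : 0 < lambda mu H ->
  ((ln (lambda mu H))%:E <= pressure mu H)%E.
Proof.
move=> l0.
have [A mA hA] : exists2 A : set T, measurable A &
    exists N, forall n, (N <= n)%N ->
    k = 1%N \/ (0 < mu (A `&` level f n))%E /\ (0 < mu (~` A `&` level f n))%E.
  have [k1|k1] := leqP k 1.
    by exists setT => //; exists 0%N => n _; left; apply/eqP; rewrite eqn_leq k1.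
  have [A [mA A1 A2]] := exists_split_set k1 gH iH; exists A => //.
  have [N1 h1] := level_positive mf mA fpos A1.
  have [N2 h2] := level_positive mf (measurableC mA) fpos A2.
  exists (maxn N1 N2) => n; rewrite geq_max => /andP[n1 n2].
  by right; split; [exact: h1|exact: h2].
have [N hN] := hA.
apply/lee_addgt0Pr => e e0.
(* A truncated mass above this threshold has logarithm at least ln lambda_H - e. *)
have r0 : 0 < lambda mu H * expR (- e) by rewrite mulr_gt0 // expR_gt0.
have rl : lambda mu H * expR (- e) < lambda mu H.
  by rewrite gtr_pMr // expR_lt1 oppr_lt0.
have [M hM] := truncated_integral_gt mf f0 fl rl.
pose n := maxn N M.
have hZ := hM n (leq_maxr _ _).
have := pressure_ge_truncation mA (lt_trans r0 hZ) (hN n (leq_maxl _ _)).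
move=> /(leeD2r e%:E); apply: le_trans.
rewrite -EFinD lee_fin -lerBlDr.
rewrite -[e in leLHS](opprK) opprK.
have -> : ln (lambda mu H) - e = ln (lambda mu H * expR (- e)).
  by rewrite lnM ?posrE ?expR_gt0 // expRK.
by rewrite ler_ln ?posrE ?ltW // (lt_trans r0).
Qed.

End lower_bound.

(** Any member would have a density of mass 1, whereas every integral is 0. *)
Lemma phi_mu_set0 (R : realType) k (mu : {measure set (borelM R k) -> \bar R}) :
  (0 < k)%N -> {ae mu, forall v : borelM R k, False} -> phi_mu mu = set0.
Proof.
move=> k0 null; apply/seteqP; split=> // L [mL iL irrL sL].
have gL : admissible mu L by split; first exact: measurableM_entries.
have := integral_density k0 gL irrL sL.
rewrite (ae_eq_integral (cst 0%E)) //.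
- by rewrite integral0 => /eqP; rewrite eqe eq_sym oner_eq0.
- by apply/measurable_EFinP; apply: measurable_density; exact: gL.1.
- by apply: filterS null.
Qed.

(** The extended logarithm gives -oo at 0, where [ln] would give 0. *)
Theorem theorem4p8 (R : realType) (k : nat) (k_gt0 : (0 < k)%N)
    (mu : {measure set (borelM R k) -> \bar R})
    (H : borelM R k -> 'M[R[i]]_k)
    (measurable_H : measurableM H)
    (sqint_H : square_integrable mu H)
    (irreducible_H : irreducible mu H)
    (H_neq0 : {ae mu, forall v, H v != 0}) :
  pressure mu H = lne (lambda mu H)%:E.
Proof.
have gH : admissible mu H by split; first exact: measurableM_entries.
have [sm smE] := sigma_finite_measureE (admissible_sigma_finite gH H_neq0).
case: k k_gt0 mu H measurable_H sqint_H irreducible_H H_neq0 gH sm smE => // k' k_gt0.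
move=> mu H mH sH iH H0 gH sm smE; subst mu.
have l0 : 0 <= lambda sm H := lambda_ge0 k_gt0 gH iH.
have [l0'|lpos] := eqVneq (lambda sm H) 0; last first.
  have {}lpos : 0 < lambda sm H by rewrite lt_neqAle eq_sym lpos.
  rewrite lne_EFin //; apply/eqP; rewrite eq_le; apply/andP; split.
    apply: ge_ereal_sup => _ [L [[mL sL iL stL] eL] <-].
    have gL : admissible sm L by split; first exact: measurableM_entries.
    exact: (variational_upper_bound k_gt0 gH iH H0 lpos gL iL stL eL).
  exact: (variational_lower_bound gH iH H0 lpos).
(* The function p is positive almost everywhere and its integral lambda_H is 0, so the measure is
   null. *)
have null : {ae sm, forall v : borelM R k'.+1, False}.
  have := integral_reference k_gt0 gH iH; rewrite l0' => I0.
  have mf := measurable_reference gH.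
  have : (\int[sm]_v `|(reference sm H v)%:E| = 0)%E.
    by under eq_integral do rewrite gee0_abs ?lee_fin ?(reference_ge0 k_gt0 gH iH) //.
  have mfE : measurable_fun setT (EFin \o reference sm H) by exact/measurable_EFinP.
  move=> /(ae_eq_integral_abs sm measurableT mfE).
  apply: filterS2 H0 => v Hv /(_ I) /= [h].
  by have := reference_gt0 k_gt0 gH iH Hv; rewrite h ltxx.
by rewrite /pressure phi_mu_set0 // set0I image_set0 ereal_sup0 l0' /= lexx.
Qed.
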